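(* Assume that a saddle point exists ($\mathcal{M}^*\neq\emptyset$), that each $f_i:\mathbb{R}^n\to\mathbb{R}$ is convex and differentiable with $L_i$-Lipschitz continuous gradient, and that each $g_i:\mathbb{R}^p\to(-\infty,+\infty]$ is convex, proper and closed ($i=1,\dots,m$). Assume $0<\tau_i<1/L_i$ and $0<\tau_i\beta<1$ for $i=1,\dots,m$. Let $\{\bar{\mathbf{x}}^k,\mathbf{x}^k,\mathbf{y}^k\}$ be generated by DISA, $\mathbf{w}^0=(\mathbf{x}^0,\mathbf{y}^0)$, and for $K\ge1$ set $\mathbf{X}^K=\frac1K\sum_{k=1}^K\bar{\mathbf{x}}^k$ and $\mathbf{Y}^K=\frac1K\sum_{k=1}^K\mathbf{y}^k$. Then for every $\mathbf{w}=(\mathbf{x},\mathbf{y})\in\mathbb{R}^{m(n+p)}\times\mathbb{R}^{m(n+p)}$, $$\mathcal{L}(\mathbf{X}^K,\mathbf{y})-\mathcal{L}(\mathbf{x},\mathbf{Y}^K)\le\frac1{2K}\|\mathbf{w}^0-\mathbf{w}\|^2_{\mathbf{H}}.$$ Moreover, writing $\mathbf{X}^K=(\mathrm{X}_1^K,\mathrm{X}_2^K)$ with blocks $\mathrm{X}^K_{1,i}\in\mathbb{R}^n$, $\mathrm{X}^K_{2,i}\in\mathbb{R}^p$ (so $\mathrm{X}_j^K=\frac1K\sum_{k=1}^K\bar{\mathrm{x}}_j^k$, $j=1,2$), $$\Big|\sum_{i=1}^m\big(f_i(\mathrm{X}_{1,i}^K)+g_i(\mathrm{X}_{2,i}^K)\big)-J^*\Big|=O(1/K),\qquad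 \big\|((I-W)\otimes I_n)^{1/2}\mathrm{X}_1^K\big\|=O(1/K),$$ where $J^*=\min_{\mathrm{x}\in\mathbb{R}^n}\sum_{i=1}^m\big(f_i(\mathrm{x})+g_i(U_i\mathrm{x})\big)$.
   Context: Network and problem. $\mathcal{G}=(\mathcal{V},\mathcal{E})$ is an undirected connected graph with $m$ nodes. $W=[W_{ij}]\in\mathbb{R}^{m\times m}$ is symmetric and doubly stochastic with $\mathrm{null}(I-W)=\mathrm{Span}(1_m)$ ($1_m$ the all-ones vector), $W_{ij}=0$ if $i\neq j$ and $(i,j)\notin\mathcal{E}$, and $W_{ij}>0$ otherwise; consequently $1$ is a simple eigenvalue of $W$ and all other eigenvalues lie in $(-1,1)$. $U_i\in\mathbb{R}^{p\times n}$ are given matrices, $L_i>0$. Lifted form. For $\mathbf{x}=(\mathrm{x}_1,\mathrm{x}_2)\in\mathbb{R}^{mn}\times\mathbb{R}^{mp}=\mathbb{R}^{m(n+p)}$ with blocks $\mathrm{x}_{1,i}\in\mathbb{R}^n$, $\mathrm{x}_{2,i}\in\mathbb{R}^p$, let $F(\mathbf{x})=\sum_{i=1}^m f_i(\mathrm{x}_{1,i})$, $G(\mathbf{x})=\sum_{i=1}^m g_i(\mathrm{x}_{2,i})$, $\mathbf{V}=\frac12(I-W)\otimes I_n$, $\mathbf{U}=\mathrm{diag}\{U_1,\dots,U_m\}$ and $$\mathbf{B}=\begin{pmatrix}\sqrt{\mathbf{V}}&0\\ \mathbf{U}&-I\end{pmatrix},$$ where $\sqrt{\mathbf V}$ is the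 positive semidefinite square root. The Lagrangian is $\mathcal{L}(\mathbf{x},\mathbf{y})=F(\mathbf{x})+G(\mathbf{x})+\langle\mathbf{y},\mathbf{B}\mathbf{x}\rangle$, $\mathbf{y}\in\mathbb{R}^{m(n+p)}$ (values in $(-\infty,+\infty]$; the bound is trivial when $G(\mathbf{x})=+\infty$). $\mathcal{M}^*$ is the set of saddle points of $\mathcal{L}$. DISA. Given $\tau_i>0$, $\beta>0$, put $\tau=\max_i\tau_i$, $\Gamma_1=\mathrm{diag}\{\tau_1I_n,\dots,\tau_mI_n\}$, $\Gamma_2=\mathrm{diag}\{\tau_1I_p,\dots,\tau_mI_p\}$, $\Gamma=\mathrm{diag}\{\Gamma_1,\Gamma_2\}$, and $$\mathbf{Q}=\begin{pmatrix}\frac1\beta I&0\\0&\mathbf{S}\end{pmatrix},\qquad \mathbf{S}=2\Gamma_2+\mathbf{U}\Gamma_1\mathbf{U}^{\top}+\frac{\beta}{1-\tau\beta}\mathbf{U}\Gamma_1^2\mathbf{U}^{\top}.$$ For symmetric positive (semi)definite $H$, $\|z\|_H^2=\langle z,Hz\rangle$, and $\mathrm{prox}^{\Gamma^{-1}}_{G}(\mathbf{v})=\arg\min_{\mathbf{x}}\{G(\mathbf{x})+\frac12\|\mathbf{x}-\mathbf{v}\|^2_{\Gamma^{-1}}\}$. Starting from arbitrary $\mathbf{x}^0$ and $\mathbf{y}^0=0$, DISA iterates for $k\ge0$: $$\bar{\mathbf{x}}^{k+1}=\mathrm{prox}^{\Gamma^{-1}}_{G}\big(\mathbf{x}^k-\Gamma\nabla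 F(\mathbf{x}^k)-\Gamma\mathbf{B}^{\top}\mathbf{y}^k\big),$$ $$\mathbf{y}^{k+1}=\arg\min_{\mathbf{y}}\Big\{\tfrac12\|\mathbf{y}-\mathbf{y}^k\|^2_{\mathbf{Q}}-\langle\mathbf{B}^{\top}\mathbf{y},\bar{\mathbf{x}}^{k+1}\rangle\Big\},$$ $$\mathbf{x}^{k+1}=\mathrm{prox}^{\Gamma^{-1}}_{G}\big(\mathbf{x}^k-\Gamma\nabla F(\mathbf{x}^k)-\Gamma\mathbf{B}^{\top}\mathbf{y}^{k+1}\big).$$ Metric. $\mathbf{H}=\mathrm{diag}\{\Gamma^{-1},\mathbf{Q}\}$ acting on $(\mathbf{x},\mathbf{y})$. The $O(1/K)$ constants are independent of $K$. *)

(* Defs.v *)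
From mathcomp Require Import all_boot all_order all_algebra.
From mathcomp Require Import all_classical all_reals all_analysis.

Set Implicit Arguments.
Unset Strict Implicit.
Unset Printing Implicit Defensive.

Import Order.TTheory GRing.Theory Num.Theory.
Import numFieldNormedType.Exports.

Local Open Scope classical_set_scope.
Local Open Scope ring_scope.

Definition inner {R : realType} {N : nat} (u v : 'cV[R]_N) : R :=
  \sum_i u i 0 * v i 0.

(* The library's norm on matrices is the sup norm. *)
Definition norm2 {R : realType} {N : nat} (u : 'cV[R]_N) : R :=
  Num.sqrt (inner u u).

(* The squared norm ||z||_H^2. *)
Definition sqnorm {R : realType} {N : nat} (H : 'M[R]_N) (z : 'cV[R]_N) : R :=
  inner z (H *m z).

Definition psd {R : realType} {N : nat} (A : 'M[R]_N) : Prop :=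
  A^T = A /\ forall z, 0 <= sqnorm A z.

(* The root exists and is unique when A is positive semidefinite;
   the default value 0 is only used for other matrices. *)
Definition mxsqrt {R : realType} {N : nat} (A : 'M[R]_N) : 'M[R]_N :=
  xget 0 [set C | psd C /\ C *m C = A].

Definition grad {R : realType} {N : nat} (f : 'cV[R]_N -> R) (x : 'cV[R]_N) :
    'cV[R]_N :=
  \col_i 'D_(delta_mx i 0) f x.

Definition argmin {R : realType} {T : Type} (phi : T -> \bar R) : set T :=
  [set x | forall z, (phi x <= phi z)%E].

Definition proper_fun {R : realType} {N : nat} (g : 'cV[R]_N -> \bar R) : Prop :=
  (forall z, g z != -oo%E) /\ exists z, (g z < +oo)%E.

Definition convex_efun {R : realType} {N : nat} (g : 'cV[R]_N -> \bar R) : Prop :=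
  forall (u v : 'cV[R]_N) (t : R), 0 <= t <= 1 ->
    (g (t *: u + (1 - t) *: v)%R <= t%:E * g u + (1 - t)%:E * g v)%E.

Definition closed_fun {R : realType} {N : nat} (g : 'cV[R]_N -> \bar R) : Prop :=
  closed [set zt : 'cV[R]_N * R | (g zt.1 <= zt.2%:E)%E].

Definition connected_graph {m : nat} (e : rel 'I_m) : Prop :=
  [/\ symmetric e, irreflexive e & forall i j, connect e i j].

Definition doubly_stochastic {R : realType} {m : nat} (W : 'M[R]_m) : Prop :=
  [/\ forall i j, 0 <= W i j, forall i, \sum_j W i j = 1
    & forall j, \sum_i W i j = 1].

Definition mixing_matrix {R : realType} {m : nat} (e : rel 'I_m) (W : 'M[R]_m) :
    Prop :=
  [/\ W^T = W, doubly_stochastic W,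
      [set v : 'cV[R]_m | (1%:M - W) *m v = 0]
        = [set c *: const_mx 1 | c in [set: R]],
      forall i j, i != j -> ~~ e i j -> W i j = 0
    & forall i j, (i == j) || e i j -> 0 < W i j].

(* R^(mn) is 'cV_(stackdim m n), split into m blocks of size n by the block
   operations of the matrix library. *)
Notation stackdim m n := (\sum_(i < m) n)%N.
Notation liftdim m n p := (stackdim m n + stackdim m p)%N.

Definition blk {R : realType} {m d : nat} (z : 'cV[R]_(stackdim m d)) (i : 'I_m) :
    'cV[R]_d :=
  @submxcol R m (fun=> d) 1 z i.

(* The Kronecker product of A with the identity matrix of size d. *)
Definition kron_id {R : realType} {m : nat} (A : 'M[R]_m) (d : nat) :
    'M[R]_(stackdim m d) :=
  \mxblock_(i < m, j < m) ((A i j)%:M : 'M[R]_d).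

Definition Fsum {R : realType} {m n p : nat} (f : 'I_m -> 'cV[R]_n -> R)
    (x : 'cV[R]_(liftdim m n p)) : R :=
  \sum_i f i (blk (usubmx x) i).

Definition Gsum {R : realType} {m n p : nat} (g : 'I_m -> 'cV[R]_p -> \bar R)
    (x : 'cV[R]_(liftdim m n p)) : \bar R :=
  (\sum_i g i (blk (dsubmx x) i))%E.

Definition Vmx {R : realType} {m : nat} (n : nat) (W : 'M[R]_m) :
    'M[R]_(stackdim m n) :=
  kron_id (2^-1 *: (1%:M - W)) n.

Definition Umx {R : realType} {m n p : nat} (U : 'I_m -> 'M[R]_(p, n)) :
    'M[R]_(stackdim m p, stackdim m n) :=
  \mxblock_(i < m, j < m) (if i == j then U i else 0).

Definition Bmx {R : realType} {m n p : nat} (W : 'M[R]_m)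
    (U : 'I_m -> 'M[R]_(p, n)) : 'M[R]_(liftdim m n p) :=
  block_mx (mxsqrt (Vmx n W)) 0 (Umx U) (- 1%:M).

Definition Lagrangian {R : realType} {m n p : nat} (f : 'I_m -> 'cV[R]_n -> R)
    (g : 'I_m -> 'cV[R]_p -> \bar R) (W : 'M[R]_m) (U : 'I_m -> 'M[R]_(p, n))
    (x y : 'cV[R]_(liftdim m n p)) : \bar R :=
  ((Fsum f x)%:E + Gsum g x + (inner y (Bmx W U *m x))%:E)%E.

Definition saddle_point {R : realType} {X Y : Type} (Lag : X -> Y -> \bar R)
    (x : X) (y : Y) : Prop :=
  (forall y', (Lag x y' <= Lag x y)%E) /\ (forall x', (Lag x y <= Lag x' y)%E).

Definition diag_tau {R : realType} {m : nat} (tau : 'I_m -> R) (d : nat) :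
    'M[R]_(stackdim m d) :=
  \mxdiag_(i < m) ((tau i)%:M : 'M[R]_d).

Definition Gammamx {R : realType} {m : nat} (n p : nat) (tau : 'I_m -> R) :
    'M[R]_(liftdim m n p) :=
  block_mx (diag_tau tau n) 0 0 (diag_tau tau p).

(* Starting the maximum at 0 is harmless: the step sizes are positive. *)
Definition tau_max {R : realType} {m : nat} (tau : 'I_m -> R) : R :=
  \big[Num.max/0]_i tau i.

Definition Smx {R : realType} {m n p : nat} (U : 'I_m -> 'M[R]_(p, n))
    (tau : 'I_m -> R) (beta : R) : 'M[R]_(stackdim m p) :=
  2 *: diag_tau tau p
  + Umx U *m diag_tau tau n *m (Umx U)^T
  + (beta / (1 - tau_max tau * beta))
    *: (Umx U *m (diag_tau tau n *m diag_tau tau n) *m (Umx U)^T).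

Definition Qmx {R : realType} {m n p : nat} (U : 'I_m -> 'M[R]_(p, n))
    (tau : 'I_m -> R) (beta : R) : 'M[R]_(liftdim m n p) :=
  block_mx (beta^-1)%:M 0 0 (Smx U tau beta).

Definition Hmx {R : realType} {m n p : nat} (U : 'I_m -> 'M[R]_(p, n))
    (tau : 'I_m -> R) (beta : R) :
    'M[R]_(liftdim m n p + liftdim m n p) :=
  block_mx (invmx (Gammamx n p tau)) 0 0 (Qmx U tau beta).

(* prox^M_G(v) as a set of minimizers; it is a singleton when M is positive
   definite and G is convex, proper and closed. *)
Definition prox {R : realType} {N : nat} (M : 'M[R]_N) (G : 'cV[R]_N -> \bar R)
    (v : 'cV[R]_N) : set 'cV[R]_N :=
  argmin (fun x => G x + (2^-1 * sqnorm M (x - v))%:E)%E.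

(* xbar 0 is unconstrained: the bar iterates start at index 1. *)
Definition DISA {R : realType} {m n p : nat} (f : 'I_m -> 'cV[R]_n -> R)
    (g : 'I_m -> 'cV[R]_p -> \bar R) (W : 'M[R]_m) (U : 'I_m -> 'M[R]_(p, n))
    (tau : 'I_m -> R) (beta : R)
    (xbar x y : nat -> 'cV[R]_(liftdim m n p)) : Prop :=
  let Gam := Gammamx n p tau in
  let B := Bmx W U in
  let P := prox (invmx Gam) (Gsum g) in
  y 0%N = 0 /\
  forall k : nat,
    [/\ P (x k - Gam *m grad (Fsum f) (x k) - Gam *m (B^T *m y k)) (xbar k.+1),
        argmin (fun z => (2^-1 * sqnorm (Qmx U tau beta) (z - y k)
                          - inner (B^T *m z) (xbar k.+1))%:E) (y k.+1)
      & P (x k - Gam *m grad (Fsum f) (x k) - Gam *m (B^T *m y k.+1)) (x k.+1)].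

Definition average {R : realType} {N : nat} (u : nat -> 'cV[R]_N) (K : nat) :
    'cV[R]_N :=
  K%:R^-1 *: \sum_(1 <= k < K.+1) u k.

Definition objective {R : realType} {m n p : nat} (f : 'I_m -> 'cV[R]_n -> R)
    (g : 'I_m -> 'cV[R]_p -> \bar R) (U : 'I_m -> 'M[R]_(p, n)) (z : 'cV[R]_n) :
    \bar R :=
  (\sum_i ((f i z)%:E + g i (U i *m z)%R))%E.

(* Main.v *)
Require Import Defs.
From mathcomp Require Import all_boot all_order all_algebra.
From mathcomp Require Import all_classical all_reals all_analysis.
From mathcomp Require Import ring lra.

Import Order.TTheory GRing.Theory Num.Theory.
Import numFieldNormedType.Exports.

Local Open Scope classical_set_scope.
Local Open Scope ring_scope.

(** The idea is a monotonicity argument in the metric H.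

    Write Phi = F + G.  The two proximal steps and the dual step give, through
    their variational inequalities (prox_vi, quadratic_argmin), bounds on
    G(xbar_{k+1}) - G(x_{k+1}), on G(x_{k+1}) - G(u) and the identity
    Q (y_{k+1} - y_k) = B xbar_{k+1}.  Convexity and smoothness of the f_i bound
    F(xbar_{k+1}) - F(u) by the linearization at x_k plus half the squared norm
    of xbar_{k+1} - x_k in the metric Gamma^-1, because L_i <= 1 / tau_i
    (Fsum_three_point).  When these are added, every scalar product becomes a
    difference of squared norms, except <B^T (y_k - y_{k+1}), x_{k+1} - xbar_{k+1}>.
    That cross term is absorbed by Young's inequality provided that
    B Gamma B^T <= Q (Bmx_Gammamx_le_Qmx), which is exactly what the matrix S is
    designed for.  The outcome (pd_step) is
      L(xbar_{k+1}, v) - L(u, y_{k+1})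
        <= (||w_k - w||_H^2 - ||w_{k+1} - w||_H^2) / 2,   w = (u, v),
    which telescopes; Jensen's inequality moves the average inside (pd_gap).

    For the rates, a saddle point (xs, ys) satisfies B xs = 0, so xs is a
    consensus vector and its value is J* (saddle_lagr, objective_min).  The gap
    bound at (xs, v) with v = ys + B X / ||B X|| bounds ||B X|| by C / K; it then
    bounds Phi(X) - J* from below by optimality of xs and from above with v = 0
    (pd_rates).  The first block of B X is sqrt(V) X_1, which is the consensus
    residual up to the factor sqrt 2.

    All of this needs sqrt(V) to be a true square root.  Since V = I - A for a
    symmetric matrix A with nonnegative entries and row sums at most 1, a root is
    obtained without any spectral theory: I - C, where C is the entrywise
    monotone limit of the iteration C <- (A + C^2) / 2 from 0
    (sym_substoch_root).

    Extended values only enter through fineG, the real-valued restriction of G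
    to its domain domG; outside of it the Lagrangian is +oo. *)

Set Implicit Arguments.
Unset Strict Implicit.
Unset Printing Implicit Defensive.

(** * Inner products and quadratic forms *)

Lemma innerE (R : realType) (N : nat) (u v : 'cV[R]_N) :
  inner u v = (u^T *m v) 0 0.
Proof. by rewrite mxE; apply: eq_bigr => i _; rewrite mxE. Qed.

Lemma innerC (R : realType) (N : nat) (u v : 'cV[R]_N) : inner u v = inner v u.
Proof. by apply: eq_bigr => i _; rewrite mulrC. Qed.

Lemma innerDr (R : realType) (N : nat) (u v w : 'cV[R]_N) :
  inner u (v + w) = inner u v + inner u w.
Proof. by rewrite !innerE mulmxDr mxE. Qed.

Lemma innerNr (R : realType) (N : nat) (u v : 'cV[R]_N) :
  inner u (- v) = - inner u v.
Proof. by rewrite !innerE mulmxN mxE. Qed.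

Lemma innerZr (R : realType) (N : nat) (a : R) (u v : 'cV[R]_N) :
  inner u (a *: v) = a * inner u v.
Proof. by rewrite !innerE -scalemxAr mxE. Qed.

Lemma inner0r (R : realType) (N : nat) (u : 'cV[R]_N) : inner u 0 = 0.
Proof. by rewrite innerE mulmx0 mxE. Qed.

Lemma innerDl (R : realType) (N : nat) (u v w : 'cV[R]_N) :
  inner (u + v) w = inner u w + inner v w.
Proof. by rewrite innerC innerDr !(innerC w). Qed.

Lemma innerNl (R : realType) (N : nat) (u v : 'cV[R]_N) :
  inner (- u) v = - inner u v.
Proof. by rewrite innerC innerNr innerC. Qed.

Lemma innerZl (R : realType) (N : nat) (a : R) (u v : 'cV[R]_N) :
  inner (a *: u) v = a * inner u v.
Proof. by rewrite innerC innerZr innerC. Qed.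

Lemma inner_sumr (R : realType) (N : nat) (I : Type) (r : seq I)
    (u : 'cV[R]_N) (v : I -> 'cV[R]_N) :
  inner u (\sum_(i <- r) v i) = \sum_(i <- r) inner u (v i).
Proof.
by elim/big_rec2: _ => [|i a b _ <-]; [exact: inner0r | rewrite innerDr].
Qed.

Lemma inner_suml (R : realType) (N : nat) (I : Type) (r : seq I)
    (u : 'cV[R]_N) (v : I -> 'cV[R]_N) :
  inner (\sum_(i <- r) v i) u = \sum_(i <- r) inner (v i) u.
Proof. by rewrite innerC inner_sumr; apply: eq_bigr => i _; rewrite innerC. Qed.

Lemma inner_adj (R : realType) (N M : nat) (A : 'M[R]_(N, M)) (u : 'cV[R]_N)
    (v : 'cV[R]_M) :
  inner u (A *m v) = inner (A^T *m u) v.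
Proof. by rewrite !innerE trmx_mul trmxK mulmxA. Qed.

Lemma inner_col_mx (R : realType) (N M : nat) (u1 v1 : 'cV[R]_N)
    (u2 v2 : 'cV[R]_M) :
  inner (col_mx u1 u2) (col_mx v1 v2) = inner u1 v1 + inner u2 v2.
Proof. by rewrite !innerE tr_col_mx mul_row_col mxE. Qed.

Lemma inner_ge0 (R : realType) (N : nat) (u : 'cV[R]_N) : 0 <= inner u u.
Proof. by apply: sumr_ge0 => i _; rewrite -expr2 sqr_ge0. Qed.

Lemma inner_eq0 (R : realType) (N : nat) (u : 'cV[R]_N) : inner u u = 0 -> u = 0.
Proof.
move=> /eqP; rewrite psumr_eq0 => [/allP u0|i _]; last by rewrite -expr2 sqr_ge0.
apply/colP => i; rewrite mxE; apply/eqP; rewrite -(sqrf_eq0 (u i 0)) expr2.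
exact: u0 (mem_index_enum i).
Qed.

Lemma norm2_ge0 (R : realType) (N : nat) (u : 'cV[R]_N) : 0 <= norm2 u.
Proof. exact: sqrtr_ge0. Qed.

Lemma norm2_sqr (R : realType) (N : nat) (u : 'cV[R]_N) :
  norm2 u ^+ 2 = inner u u.
Proof. by rewrite sqr_sqrtr ?inner_ge0. Qed.

Lemma norm2_eq0 (R : realType) (N : nat) (u : 'cV[R]_N) : norm2 u = 0 -> u = 0.
Proof. by move=> u0; apply: inner_eq0; rewrite -norm2_sqr u0 expr0n. Qed.

Lemma norm2Z (R : realType) (N : nat) (a : R) (u : 'cV[R]_N) :
  norm2 (a *: u) = `|a| * norm2 u.
Proof.
by rewrite /norm2 innerZl innerZr mulrA -expr2 sqrtrM ?sqr_ge0// sqrtr_sqr.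
Qed.

(** Cauchy-Schwarz, from the nonnegativity of || |v| u - |u| v ||^2. *)
Lemma inner_le_norm2 (R : realType) (N : nat) (u v : 'cV[R]_N) :
  inner u v <= norm2 u * norm2 v.
Proof.
have [v0|v0] := eqVneq (norm2 v) 0.
  by rewrite (norm2_eq0 v0) inner0r (_ : norm2 0 = 0) ?mulr0// /norm2 inner0r sqrtr0.
have [u0|u0] := eqVneq (norm2 u) 0.
  rewrite (norm2_eq0 u0) innerC inner0r (_ : norm2 0 = 0) ?mul0r//.
  by rewrite /norm2 inner0r sqrtr0.
have un : 0 < norm2 u by rewrite lt_neqAle eq_sym u0 norm2_ge0.
have vn : 0 < norm2 v by rewrite lt_neqAle eq_sym v0 norm2_ge0.
have := inner_ge0 (norm2 v *: u - norm2 u *: v).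
rewrite !(innerDr, innerDl, innerNr, innerNl, innerZl, innerZr).
rewrite (innerC v u) -!norm2_sqr => h.
by rewrite -(ler_pM2l (mulr_gt0 un vn)); nra.
Qed.

Lemma sqnorm_symD (R : realType) (N : nat) (M : 'M[R]_N) (u v : 'cV[R]_N) :
  M^T = M -> sqnorm M (u + v) = sqnorm M u + 2 * inner (M *m u) v + sqnorm M v.
Proof.
move=> Ms; rewrite /sqnorm mulmxDr !innerDr !innerDl.
by rewrite (inner_adj _ u v) Ms (innerC v); ring.
Qed.

Lemma sqnormZ (R : realType) (N : nat) (M : 'M[R]_N) (a : R) (u : 'cV[R]_N) :
  sqnorm M (a *: u) = a ^+ 2 * sqnorm M u.
Proof. by rewrite /sqnorm -scalemxAr innerZl innerZr; ring. Qed.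

Lemma sqnormN (R : realType) (N : nat) (M : 'M[R]_N) (u : 'cV[R]_N) :
  sqnorm M (- u) = sqnorm M u.
Proof. by rewrite -scaleN1r sqnormZ sqrrN expr1n mul1r. Qed.

(** The polarization identity that turns the scalar products of the variational
    inequalities into differences of squared distances, which telescope. *)
Lemma inner_polarization (R : realType) (N : nat) (M : 'M[R]_N)
    (a b c : 'cV[R]_N) : M^T = M ->
  inner (M *m (b - a)) (c - b) =
    2^-1 * (sqnorm M (c - a) - sqnorm M (c - b) - sqnorm M (b - a)).
Proof.
move=> Ms.
rewrite (_ : c - a = (b - a) + (c - b)); last by rewrite [RHS]addrC subrKA.
by rewrite (sqnorm_symD _ (c - b) Ms); lra.
Qed.

(** * Square roots of Laplacian-like matrices *)

Definition sym_substoch (R : realType) (N : nat) (A : 'M[R]_N) : Prop :=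
  [/\ A^T = A, forall i j, 0 <= A i j & forall i, \sum_j A i j <= 1].

(** Both signs s = 1 and s = -1 are used: the eigenvalues of A lie in [-1, 1].
    The proof bounds each s * z_i * z_j by (z_i^2 + z_j^2) / 2 and sums. *)
Lemma sym_substoch_sqnorm_le (R : realType) (N : nat) (A : 'M[R]_N) (s : R)
    (z : 'cV[R]_N) :
  sym_substoch A -> s ^+ 2 = 1 -> s * sqnorm A z <= inner z z.
Proof.
move=> [As A0 A1] s1.
have E : s * sqnorm A z = \sum_i \sum_j A i j * (s * (z i 0 * z j 0)).
  rewrite /sqnorm /inner mulr_sumr; apply: eq_bigr => i _.
  by rewrite mxE !mulr_sumr; apply: eq_bigr => j _; ring.
rewrite E.
have half : \sum_i \sum_j A i j * z i 0 ^+ 2 <= inner z z.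
  apply: ler_sum => i _; rewrite -mulr_suml -expr2.
  by rewrite -[leRHS]mul1r ler_wpM2r ?sqr_ge0.
have half' : \sum_i \sum_j A i j * z j 0 ^+ 2 <= inner z z.
  rewrite exchange_big; apply: le_trans half; apply: ler_sum => i _.
  by apply: ler_sum => j _; rewrite -{1}As mxE.
apply: (@le_trans _ _ (2^-1 * (\sum_i \sum_j A i j * z i 0 ^+ 2)
   + 2^-1 * (\sum_i \sum_j A i j * z j 0 ^+ 2))); last by lra.
rewrite !mulr_sumr -big_split; apply: ler_sum => i _ /=.
rewrite !mulr_sumr -big_split; apply: ler_sum => j _ /=.
have := sqr_ge0 (z i 0 - s * z j 0); have := A0 i j.
move: (A i j) (z i 0) (z j 0) => a b c a0 h.
have {}h : s * (b * c) <= 2^-1 * b ^+ 2 + 2^-1 * c ^+ 2 by nra.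
by have := ler_wpM2l a0 h; lra.
Qed.

(** Looking for the root in the form I - C, the equation (I - C)^2 = I - A reads
    C = (A + C^2) / 2.  Iterating from 0, nonnegativity of A makes the iterates
    increase entrywise and the row-sum bound is preserved, so they converge; the
    limit has row sums at most 1, which makes I - C positive semidefinite. *)
Lemma sym_substoch_root (R : realType) (N : nat) (A : 'M[R]_N) :
  sym_substoch A -> exists C, psd C /\ C *m C = 1%:M - A.
Proof.
move=> [As A0 A1].
pose T (C : 'M[R]_N) := 2^-1 *: (A + C *m C).
pose Cn k := iter k T 0.
have TE C i j : T C i j = 2^-1 * (A i j + \sum_l C i l * C l j).
  by rewrite !mxE.
have Cp k : sym_substoch (Cn k).
  elim: k => [|k [Cs C0 C1]].
    split => [|i j|i]; rewrite ?trmx0 ?mxE//.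
    by rewrite big1// => j _; rewrite mxE.
  rewrite /Cn iterS -/(Cn k); split.
  - by rewrite /T linearZ/= linearD/= trmx_mul Cs As.
  - move=> i j; rewrite TE mulr_ge0 ?invr_ge0 ?addr_ge0 ?sumr_ge0// => l _.
    exact: mulr_ge0.
  - move=> i; under eq_bigr do rewrite TE.
    rewrite -mulr_sumr big_split/= exchange_big/=.
    have -> : \sum_j \sum_l Cn k i j * Cn k j l = \sum_j Cn k i j * \sum_l Cn k j l.
      by apply: eq_bigr => j _; rewrite mulr_sumr.
    have : \sum_j Cn k i j * \sum_l Cn k j l <= \sum_j Cn k i j.
      by apply: ler_sum => j _; rewrite -[leRHS]mulr1 ler_wpM2l.
    have := A1 i; have := C1 i; lra.
have Cmon k i j : Cn k i j <= Cn k.+1 i j.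
  elim: k i j => [|k IH] i j.
    by rewrite [Cn 0%N i j]mxE; have [_ + _] := Cp 1%N; apply.
  rewrite [Cn k.+2 i j]TE [Cn k.+1 i j]TE ler_pM2l ?invr_gt0// lerD2l.
  apply: ler_sum => l _; apply: ler_pM => //; by have [_ + _] := Cp k; apply.
have Cle1 k i j : Cn k i j <= 1.
  have [_ C0 C1] := Cp k; apply: le_trans (C1 i).
  by rewrite (bigD1 j)//= lerDl sumr_ge0.
pose C : 'M[R]_N := \matrix_(i, j) limn (fun k => Cn k i j).
have Ccv i j : (fun k => Cn k i j) @ \oo --> C i j.
  rewrite mxE; apply: nondecreasing_is_cvgn.
    by apply/nondecreasing_seqP => k; exact: Cmon.
  by exists 1 => _ [k _ <-]; exact: Cle1.
have CC : C = T C.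
  apply/matrixP => i j; rewrite TE.
  have h : (fun k => Cn k.+1 i j) @ \oo -->
      2^-1 * (A i j + \sum_l C i l * C l j).
    under eq_fun do rewrite /Cn iterS -/(Cn _) TE.
    apply: cvgM; first exact: cvg_cst.
    apply: cvgD; first exact: cvg_cst.
    apply: (cvg_big add_continuous) => l _; exact: cvgM.
  have h' : (fun k => Cn k.+1 i j) @ \oo --> C i j.
    by have := Ccv i j; rewrite -(cvg_shiftS (fun k => Cn k i j)).
  exact: (cvg_unique _ h' h).
have Cst : sym_substoch C.
  split.
  - apply/matrixP => i j; rewrite !mxE.
    suff -> : (fun k => Cn k j i) = (fun k => Cn k i j) by [].
    by apply/funext => k; have [Cs _ _] := Cp k; rewrite -{1}Cs mxE.
  - move=> i j; apply: (cvgr_to_ge (Ccv i j)); apply: nearW => k.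
    by have [_ + _] := Cp k; apply.
  - move=> i.
    have h : (fun k => \sum_j Cn k i j) @ \oo --> \sum_j C i j.
      by apply: (cvg_big add_continuous) => j _; exact: Ccv.
    apply: (cvgr_to_le h); apply: nearW => k.
    by have [_ _ +] := Cp k; apply.
exists (1%:M - C); split; first split.
- by case: Cst => Cs _ _; rewrite linearB/= trmx1 Cs.
- move=> z; rewrite /sqnorm mulmxBl mul1mx innerDr innerNr subr_ge0.
  by have := sym_substoch_sqnorm_le z Cst (expr1n _ 2); rewrite mul1r.
- rewrite mulmxBl mul1mx mulmxBr mulmx1.
  have -> : C *m C = 2 *: C - A.
    by rewrite [in RHS]CC /T scalerA divff ?pnatr_eq0// scale1r addrC addKr.
  by apply/matrixP => i j; rewrite !mxE; ring.
Qed.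

(** * Block vectors and lifted matrices *)

(** Lets identities between block matrices be checked on vectors, block by block,
    where they reduce to identities between scalars. *)
Lemma eq_mulmx_cV (R : realType) (M N : nat) (A B : 'M[R]_(M, N)) :
  (forall z : 'cV[R]_N, A *m z = B *m z) -> A = B.
Proof.
move=> AB; apply/matrixP => i j.
by have /(congr1 (fun c : 'cV_M => c i 0)) := AB (delta_mx j 0); rewrite -!colE !mxE.
Qed.

Lemma blkD (R : realType) (m : nat)
    d (u v : 'cV[R]_(stackdim m d)) i : blk (u + v) i = blk u i + blk v i.
Proof. exact: submxcolD. Qed.

Lemma blkN (R : realType) (m : nat)
    d (u : 'cV[R]_(stackdim m d)) i : blk (- u) i = - blk u i.
Proof. exact: submxcolN. Qed.

Lemma blkZ (R : realType) (m : nat)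
    d (a : R) (u : 'cV[R]_(stackdim m d)) i : blk (a *: u) i = a *: blk u i.
Proof. by apply/colP => k; rewrite !mxE. Qed.

Lemma eq_blk (R : realType) (m : nat) d (u v : 'cV[R]_(stackdim m d)) :
  (forall i, blk u i = blk v i) -> u = v.
Proof. by move=> uv; apply/mxcolP. Qed.

Lemma blk_mxcol (R : realType) (m : nat) d (z : 'I_m -> 'cV[R]_d) i :
  blk (\mxcol_i z i : 'cV[R]_(stackdim m d)) i = z i.
Proof. exact: mxcolK. Qed.

Lemma blk_mul_mxblock (R : realType) (m : nat)
    d d' (B : 'I_m -> 'I_m -> 'M[R]_(d, d'))
    (z : 'cV[R]_(stackdim m d')) i :
  blk (\mxblock_(i, j) B i j *m z : 'cV[R]_(stackdim m d)) i
    = \sum_j B i j *m blk z j.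
Proof.
rewrite -{1}(submxcolK z).
have -> := @mul_mxblock_mxrow R m m (fun=> d') (fun=> d) 1 B (submxcol z).
exact: blk_mxcol.
Qed.

Lemma blk_kron (R : realType) (m : nat)
    (A : 'M[R]_m) d (z : 'cV[R]_(stackdim m d)) i :
  blk (kron_id A d *m z) i = \sum_j A i j *: blk z j.
Proof.
by rewrite blk_mul_mxblock; apply: eq_bigr => j _; rewrite mul_scalar_mx.
Qed.

Lemma blk_Umx (R : realType) (m : nat)
    n p (U : 'I_m -> 'M[R]_(p, n)) (z : 'cV[R]_(stackdim m n)) i :
  blk (Umx U *m z) i = U i *m blk z i.
Proof.
rewrite blk_mul_mxblock (bigD1 i)//= eqxx big1 ?addr0// => j ji.
by rewrite eq_sym (negPf ji) mul0mx.
Qed.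

Lemma blk_diag_tau (R : realType) (m : nat)
    (t : 'I_m -> R) d (z : 'cV[R]_(stackdim m d)) i :
  blk (diag_tau t d *m z) i = t i *: blk z i.
Proof.
rewrite -{1}(submxcolK z).
have -> := @mul_mxdiag_mxcol R m (fun=> d) 1 (fun i => (t i)%:M) (submxcol z).
by rewrite blk_mxcol mul_scalar_mx.
Qed.

Lemma tr_diag_tau (R : realType) (m : nat)
    (t : 'I_m -> R) d : (diag_tau t d)^T = diag_tau t d.
Proof. by rewrite tr_mxdiag; apply: eq_mxdiag => i; rewrite tr_scalar_mx. Qed.

Lemma inner_blk (R : realType) (m : nat) d (u v : 'cV[R]_(stackdim m d)) :
  inner u v = \sum_i inner (blk u i) (blk v i).
Proof.
rewrite innerE -{1}(submxcolK u) -{1}(submxcolK v) tr_mxcol mul_mxrow_mxcol.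
by rewrite summxE; apply: eq_bigr => i _; rewrite innerE.
Qed.

Lemma kron_idB (R : realType) (m : nat)
    (A B : 'M[R]_m) d : kron_id (A - B) d = kron_id A d - kron_id B d.
Proof.
apply: eq_mulmx_cV => z; apply: eq_blk => i.
rewrite mulmxBl blkD blkN !blk_kron -sumrB.
by apply: eq_bigr => j _; rewrite !mxE scalerBl.
Qed.

Lemma kron_idZ (R : realType) (m : nat)
    (a : R) (A : 'M[R]_m) d : kron_id (a *: A) d = a *: kron_id A d.
Proof.
apply: eq_mulmx_cV => z; apply: eq_blk => i.
rewrite -scalemxAl blkZ !blk_kron scaler_sumr.
by apply: eq_bigr => j _; rewrite !mxE scalerA.
Qed.

Lemma kron_id1 (R : realType) (m : nat) d : kron_id (1%:M : 'M[R]_m) d = 1%:M.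
Proof.
apply: eq_mulmx_cV => z; apply: eq_blk => i.
rewrite mul1mx blk_kron (bigD1 i)//= mxE eqxx scale1r big1 ?addr0// => j ji.
by rewrite mxE eq_sym (negPf ji) scale0r.
Qed.

Lemma tr_kron_id (R : realType) (m : nat)
    (A : 'M[R]_m) d : A^T = A -> (kron_id A d)^T = kron_id A d.
Proof.
move=> As; rewrite tr_mxblock; apply: eq_mxblock => i j.
by rewrite tr_scalar_mx -{1}As mxE.
Qed.

Lemma sym_substoch_kron (R : realType) (m : nat)
    (A : 'M[R]_m) d : sym_substoch A -> sym_substoch (kron_id A d).
Proof.
move=> [As A0 A1]; split; first exact: tr_kron_id.
  by move=> i j; rewrite !mxE mulrn_wge0.
have E : kron_id A d *m const_mx 1 = \mxcol_i (const_mx (\sum_j A i j) : 'cV[R]_d).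
  apply: eq_blk => i; rewrite blk_kron blk_mxcol; apply/colP => k.
  by rewrite summxE mxE; apply: eq_bigr => j _; rewrite !mxE mulr1.
move=> i; apply: le_trans (A1 (tagnat.sig1 i)).
have /(congr1 (fun c : 'cV_(stackdim m d) => c i 0)) := E.
rewrite [RHS]mxE [RHS]mxE => <-; rewrite mxE.
by apply: ler_sum => j _; rewrite [const_mx _ _ _]mxE mulr1.
Qed.

(** * The consensus matrix V *)

Lemma mixing_sym_substoch (R : realType) (m : nat)
    (e : rel 'I_m) (W : 'M[R]_m) :
  mixing_matrix e W -> sym_substoch W.
Proof. by case=> Ws [W0 W1 _] _ _ _; split => // i; rewrite W1. Qed.

(** V = I - (I + W) / 2, and this is the matrix of the lazy walk, to which
    the square root construction applies. *)
Lemma sym_substoch_lazy (R : realType) (m : nat) (W : 'M[R]_m) :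
  sym_substoch W -> sym_substoch (2^-1 *: (1%:M + W)).
Proof.
move=> [Ws W0 W1]; split.
- by rewrite linearZ/= linearD/= trmx1 Ws.
- by move=> i j; rewrite !mxE mulr_ge0// ?invr_ge0// addr_ge0// ler0n.
- move=> i; under eq_bigr do rewrite !mxE.
  rewrite -mulr_sumr big_split/= (bigD1 i)//= eqxx/= mulr1n big1 ?addr0.
    by have := W1 i; lra.
  by move=> j ji; rewrite eq_sym (negPf ji).
Qed.

Lemma VmxE (R : realType) (m n : nat) (W : 'M[R]_m) :
  Vmx n W = 1%:M - kron_id (2^-1 *: (1%:M + W)) n.
Proof.
rewrite -kron_id1 -kron_idB; congr (kron_id _ n).
by apply/matrixP => i j; rewrite !mxE; lra.
Qed.

Lemma mxsqrt_root (R : realType) (N : nat) (A : 'M[R]_N) :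
  (exists C, psd C /\ C *m C = A) ->
  (mxsqrt A)^T = mxsqrt A /\ mxsqrt A *m mxsqrt A = A.
Proof. by move=> /(xgetPex 0) [[? _] ?]. Qed.

Lemma Vmx_psd_root (R : realType) (m n : nat) (e : rel 'I_m) (W : 'M[R]_m) :
  mixing_matrix e W -> exists C, psd C /\ C *m C = Vmx n W.
Proof.
move=> /mixing_sym_substoch /sym_substoch_lazy /(sym_substoch_kron n).
move=> /sym_substoch_root.
by rewrite VmxE.
Qed.

Lemma kron_laplacian_psd_root (R : realType) (m n : nat) (e : rel 'I_m) (W : 'M[R]_m) :
  mixing_matrix e W ->
  exists C, psd C /\ C *m C = kron_id (1%:M - W) n.
Proof.
move=> /(Vmx_psd_root n) [C [[Cs C0] CC]]; exists (Num.sqrt 2 *: C); split; first split.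
- by rewrite linearZ/= Cs.
- by move=> z; rewrite /sqnorm -scalemxAl innerZr mulr_ge0 ?sqrtr_ge0//; exact: C0.
- rewrite -scalemxAl -scalemxAr scalerA -expr2 sqr_sqrtr// CC /Vmx kron_idZ.
  by rewrite scalerA divff ?scale1r// pnatr_eq0.
Qed.

Lemma norm2_root (R : realType) (N : nat) (A C : 'M[R]_N) (z : 'cV[R]_N) :
  C^T = C -> C *m C = A -> norm2 (C *m z) ^+ 2 = inner z (A *m z).
Proof. by move=> Cs <-; rewrite norm2_sqr -mulmxA (inner_adj C z) Cs. Qed.

(** This is W >= -I in quadratic form. *)
Lemma Vmx_le1 (R : realType) (m n : nat) (e : rel 'I_m) (W : 'M[R]_m)
    (z : 'cV[R]_(stackdim m n)) :
  mixing_matrix e W -> inner z (Vmx n W *m z) <= inner z z.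
Proof.
move=> /mixing_sym_substoch /(sym_substoch_kron n) Wst.
have -> : Vmx n W = 2^-1 *: (1%:M - kron_id W n).
  by rewrite /Vmx kron_idZ kron_idB kron_id1.
rewrite -scalemxAl mulmxBl mul1mx innerZr innerDr innerNr.
have N1 : (-1) ^+ 2 = 1 :> R by rewrite sqrrN expr1n.
by have := sym_substoch_sqnorm_le z Wst N1; rewrite /sqnorm; lra.
Qed.

(** Each of the n coordinates, read across the m agents, is a vector in the kernel
    of I - W, hence a multiple of the all-ones vector.  With no agents at all any
    common value will do. *)
Lemma Vmx_consensus (R : realType) (m n : nat) (e : rel 'I_m) (W : 'M[R]_m)
    (z : 'cV[R]_(stackdim m n)) : mixing_matrix e W ->
  Vmx n W *m z = 0 <-> exists c, forall i, blk z i = c.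
Proof.
case=> _ _ kerW _ _.
have coord (c : 'I_n) i : (((1%:M - W) *m \col_j blk z j c 0) i 0)
    = 2 * blk (Vmx n W *m z) i c 0.
  rewrite blk_kron summxE mulr_sumr mxE; apply: eq_bigr => j _.
  by rewrite !mxE; lra.
split=> [Vz|[c zc]].
  have zE i j : blk z i = blk z j.
    apply/colP => c.
    have : [set v : 'cV[R]_m | (1%:M - W) *m v = 0] (\col_j blk z j c 0).
      by apply/colP => k; rewrite coord Vz !mxE mulr0.
    rewrite kerW => -[a _ /colP aE].
    by have := aE i; have := aE j; rewrite !mxE => <- <-.
  have [i0 _|m0] := pickP (fun _ : 'I_m => true); first by exists (blk z i0).
  by exists 0 => i; have := m0 i.
apply: eq_blk => i; apply/colP => k; apply: (@mulfI _ 2); first by rewrite pnatr_eq0.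
rewrite -coord.
have : [set c *: const_mx 1 | c in [set: R]] (\col_j blk z j k 0).
  exists (c k 0) => //; apply/colP => j; by rewrite !mxE mulr1 -(zc j) mxE.
by rewrite -kerW /= => ->; rewrite !mxE mulr0.
Qed.

(** * The metrics Gamma and Q *)

Lemma tau_max_ge (R : realType) (m : nat)
    (tau : 'I_m -> R) i : tau i <= tau_max tau.
Proof. exact: le_bigmax. Qed.

Lemma tau_max_lt (R : realType) (m : nat) (tau : 'I_m -> R) (beta : R) :
  0 < beta -> (forall i, 0 < tau i * beta < 1) -> 0 <= tau_max tau * beta < 1.
Proof.
move=> b0 tb; apply/andP; split; last first.
  rewrite -ltr_pdivlMr//; apply: bigmax_lt => [|i _]; first by rewrite mul1r invr_gt0.
  by rewrite ltr_pdivlMr//; case/andP: (tb i).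
by apply: mulr_ge0; [exact: bigmax_ge_id | exact: ltW].
Qed.

Lemma inner_diag_tau (R : realType) (m : nat) (t : 'I_m -> R) d
    (u v : 'cV[R]_(stackdim m d)) :
  inner u (diag_tau t d *m v) = \sum_i t i * inner (blk u i) (blk v i).
Proof.
by rewrite inner_blk; apply: eq_bigr => i _; rewrite blk_diag_tau innerZr.
Qed.

Lemma diag_tau_ge0 (R : realType) (m : nat) (t : 'I_m -> R) d
    (u : 'cV[R]_(stackdim m d)) :
  (forall i, 0 <= t i) -> 0 <= inner u (diag_tau t d *m u).
Proof.
by move=> t0; rewrite inner_diag_tau sumr_ge0// => i _; rewrite mulr_ge0 ?inner_ge0.
Qed.

Lemma tr_Gammamx (R : realType) (m n p : nat) (tau : 'I_m -> R) :
  (Gammamx n p tau)^T = Gammamx n p tau.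
Proof. by rewrite tr_block_mx !trmx0 !tr_diag_tau. Qed.

Lemma Gammamx_mul (R : realType) (m n p : nat) (s t : 'I_m -> R) :
  (forall i, s i * t i = 1) -> Gammamx n p s *m Gammamx n p t = 1%:M.
Proof.
move=> st; rewrite mulmx_block !mulmx0 !mul0mx !addr0 !add0r.
have D d : diag_tau s d *m diag_tau t d = 1%:M.
  apply: eq_mulmx_cV => z; apply: eq_blk => i.
  by rewrite -mulmxA !blk_diag_tau scalerA st scale1r mul1mx.
by rewrite !D -scalar_mx_block.
Qed.

Lemma invmx_Gammamx (R : realType) (m n p : nat) (tau : 'I_m -> R) :
  (forall i, 0 < tau i) ->
  invmx (Gammamx n p tau) = Gammamx n p (fun i => (tau i)^-1).
Proof.
move=> t0.
have E : Gammamx n p tau *m Gammamx n p (fun i => (tau i)^-1) = 1%:M.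
  by apply: Gammamx_mul => i; rewrite divff// gt_eqF.
have [U _] := mulmx1_unit E.
by rewrite -[LHS]mulmx1 -E mulmxA mulVmx// mul1mx.
Qed.

Lemma sqnorm_Gammamx (R : realType) (m n p : nat) (t : 'I_m -> R)
    (z : 'cV[R]_(liftdim m n p)) :
  sqnorm (Gammamx n p t) z = inner (usubmx z) (diag_tau t n *m usubmx z)
    + inner (dsubmx z) (diag_tau t p *m dsubmx z).
Proof.
rewrite /sqnorm -{1 2}(vsubmxK z) mul_block_col !mul0mx addr0 add0r.
exact: inner_col_mx.
Qed.

Lemma Gammamx_ge0 (R : realType) (m n p : nat) (t : 'I_m -> R)
    (z : 'cV[R]_(liftdim m n p)) :
  (forall i, 0 <= t i) -> 0 <= sqnorm (Gammamx n p t) z.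
Proof. by move=> t0; rewrite sqnorm_Gammamx addr_ge0// diag_tau_ge0. Qed.

Lemma tr_Qmx (R : realType) (m n p : nat) (U : 'I_m -> 'M[R]_(p, n))
    (tau : 'I_m -> R) (beta : R) : (Qmx U tau beta)^T = Qmx U tau beta.
Proof.
rewrite /Qmx tr_block_mx !trmx0 tr_scalar_mx /Smx; set k := beta / _.
congr (block_mx _ _ _ _).
by rewrite !linearD/= !linearZ/= !trmx_mul !trmxK !tr_diag_tau !mulmxA.
Qed.

Lemma sqnorm_Qmx (R : realType) (m n p : nat) (U : 'I_m -> 'M[R]_(p, n))
    (tau : 'I_m -> R) (beta : R) (a : 'cV[R]_(stackdim m n))
    (b : 'cV[R]_(stackdim m p)) (r := (Umx U)^T *m b) :
  sqnorm (Qmx U tau beta) (col_mx a b) =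
    beta^-1 * inner a a + 2 * inner b (diag_tau tau p *m b)
    + inner r (diag_tau tau n *m r)
    + beta / (1 - tau_max tau * beta)
      * inner (diag_tau tau n *m r) (diag_tau tau n *m r).
Proof.
rewrite /sqnorm mul_block_col !mul0mx addr0 add0r inner_col_mx mul_scalar_mx.
rewrite innerZr /Smx !mulmxDl !innerDr -!scalemxAl !innerZr -!mulmxA.
rewrite !(inner_adj (Umx U)) -/r.
by rewrite (inner_adj _ r (diag_tau tau n *m r)) tr_diag_tau !addrA.
Qed.

Lemma Qmx_ge0 (R : realType) (m n p : nat) (U : 'I_m -> 'M[R]_(p, n))
    (tau : 'I_m -> R) (beta : R) (z : 'cV[R]_(liftdim m n p)) :
  0 < beta -> (forall i, 0 < tau i * beta < 1) ->
  0 <= sqnorm (Qmx U tau beta) z.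
Proof.
move=> b0 tb; have [_ tb1] := andP (tau_max_lt b0 tb).
have t0 i : 0 <= tau i by have /andP[+ _] := tb i; rewrite pmulr_lgt0// => /ltW.
rewrite -(vsubmxK z) sqnorm_Qmx.
have k0 : 0 <= beta / (1 - tau_max tau * beta) by rewrite divr_ge0// ?subr_ge0 ltW.
apply: addr_ge0; last by rewrite mulr_ge0 ?inner_ge0.
apply: addr_ge0; first apply: addr_ge0.
- by rewrite mulr_ge0 ?inner_ge0// invr_ge0 ltW.
- by rewrite mulr_ge0// diag_tau_ge0.
- exact: diag_tau_ge0.
Qed.

(** The key domination B Gamma B^T <= Q.  With z = (a, b), c = sqrt(V) a and
    q = Gamma_1 U^T b, the U Gamma_1 U^T and Gamma_2 terms cancel and what remains
    is 2 <c, q> <= (1/beta - tau) |c|^2 + beta / (1 - tau beta) |q|^2, a perfect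
    square, where |c|^2 <= |a|^2 because V <= I. *)
Lemma Bmx_Gammamx_le_Qmx (R : realType) (m n p : nat) (e : rel 'I_m) (W : 'M[R]_m)
    (U : 'I_m -> 'M[R]_(p, n)) (tau : 'I_m -> R) (beta : R)
    (z : 'cV[R]_(liftdim m n p)) :
  mixing_matrix e W -> 0 < beta -> (forall i, 0 < tau i * beta < 1) ->
  sqnorm (Gammamx n p tau) ((Bmx W U)^T *m z) <= sqnorm (Qmx U tau beta) z.
Proof.
move=> mW b0 tb; have [_ tb1] := andP (tau_max_lt b0 tb).
have t0 i : 0 <= tau i by have /andP[+ _] := tb i; rewrite pmulr_lgt0// => /ltW.
have [Cs CC] := mxsqrt_root (Vmx_psd_root n mW).
rewrite -(vsubmxK z); set a := usubmx z; set b := dsubmx z.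
rewrite sqnorm_Qmx tr_block_mx mul_block_col trmx0 mul0mx add0r Cs.
set r := (Umx U)^T *m b; set c := mxsqrt (Vmx n W) *m a.
rewrite linearN/= trmx1 mulNmx mul1mx sqnorm_Gammamx col_mxKu col_mxKd.
rewrite mulmxN innerNl innerNr opprK.
rewrite mulmxDr !innerDr !innerDl.
have -> : inner r (diag_tau tau n *m c) = inner c (diag_tau tau n *m r).
  by rewrite inner_adj tr_diag_tau innerC.
set q := diag_tau tau n *m r.
have cc : inner c c <= inner a a.
  by rewrite -norm2_sqr (norm2_root _ Cs CC); exact: Vmx_le1 mW.
have ct : inner c (diag_tau tau n *m c) <= tau_max tau * inner c c.
  rewrite inner_diag_tau inner_blk mulr_sumr; apply: ler_sum => i _.
  by rewrite ler_wpM2r ?inner_ge0 ?tau_max_ge.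
have bb : 0 <= inner b (diag_tau tau p *m b) by exact: diag_tau_ge0.
(* The perfect square behind the bound on the cross term 2 <c, q>. *)
have sq := inner_ge0 ((1 - tau_max tau * beta) *: c - beta *: q).
rewrite !(innerDr, innerDl, innerNr, innerNl, innerZl, innerZr) (innerC q c) in sq.
set s := 1 - tau_max tau * beta in sq *.
have s0 : 0 < s by rewrite subr_gt0.
have key : 2 * inner c q <= s / beta * inner c c + beta / s * inner q q.
  rewrite -subr_ge0.
  have -> : s / beta * inner c c + beta / s * inner q q - 2 * inner c q =
    (s * beta)^-1
      * (s * (s * inner c c) - s * (beta * inner c q)
         - (beta * (s * inner c q) - beta * (beta * inner q q))).
    by field; rewrite !gt_eqF.
  apply: mulr_ge0; first by rewrite invr_ge0 mulr_ge0 ?ltW.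
  by move: sq; lra.
have aa : s / beta * inner c c + tau_max tau * inner c c <= beta^-1 * inner a a.
  have -> : s / beta * inner c c + tau_max tau * inner c c = beta^-1 * inner c c.
    by rewrite /s; field; rewrite gt_eqF.
  by rewrite ler_wpM2l// invr_ge0 ltW.
by lra.
Qed.

(** * Convexity and minimization *)

(** First-order conditions are obtained by comparing a minimizer with a point at
    distance t along a segment, dividing by t and letting t tend to 0. *)
Lemma le0_of_small_multiples (R : realType) (c b : R) :
  (forall t, 0 < t <= 1 -> c <= t * b) -> c <= 0.
Proof.
move=> h; rewrite leNgt; apply/negP => c0.
have d0 : 0 < c + `|b| by rewrite ltr_pwDl.
(* A value of t small enough that t * b < c. *)
have t01 : 0 < c / (2 * (c + `|b|)) <= 1.
  rewrite divr_gt0 ?mulr_gt0// ler_pdivrMr ?mulr_gt0// mul1r.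
  by have := normr_ge0 b; lra.
have := h _ t01; rewrite mulrAC ler_pdivlMr ?mulr_gt0//.
have := ler_norm b; have := normr_ge0 b; nra.
Qed.

(** A real-valued stand-in for an extended-valued convex function: D plays the
    role of its domain. *)
Definition convex_on (R : realType) (N : nat) (D : 'cV[R]_N -> Prop)
    (h : 'cV[R]_N -> R) : Prop :=
  forall (u v : 'cV[R]_N) (t : R), 0 <= t <= 1 -> D u -> D v ->
    D (t *: u + (1 - t) *: v)
    /\ h (t *: u + (1 - t) *: v) <= t * h u + (1 - t) * h v.

Lemma convex_onD (R : realType) (N : nat) (D : 'cV[R]_N -> Prop)
    (h k : 'cV[R]_N -> R) :
  convex_on D h -> convex_on D k -> convex_on D (fun x => h x + k x).
Proof.
move=> hc kc u v t t01 Du Dv; have [D1 h1] := hc u v t t01 Du Dv.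
by have [_ k1] := kc u v t t01 Du Dv; split => //; lra.
Qed.

Lemma average_weight (R : realType) (K : nat) :
  (1 - K.+2%:R^-1) * K.+1%:R^-1 = K.+2%:R^-1 :> R.
Proof.
have k0 : 0 < K.+1%:R :> R by rewrite ltr0n.
rewrite -[K.+2%:R]natr1; move: K.+1%:R k0 => k k0.
by field; rewrite !gt_eqF ?addr_gt0.
Qed.

Lemma averageS (R : realType) (N : nat) (u : nat -> 'cV[R]_N) (K : nat) :
  average u K.+2 = K.+2%:R^-1 *: u K.+2 + (1 - K.+2%:R^-1) *: average u K.+1.
Proof.
by rewrite /average big_nat_recr//= scalerDr addrC scalerA average_weight.
Qed.

Lemma jensen_average (R : realType) (N : nat) (D : 'cV[R]_N -> Prop)
    (h : 'cV[R]_N -> R) (u : nat -> 'cV[R]_N) (K : nat) : (1 <= K)%N ->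
  convex_on D h -> (forall k, D (u k.+1)) ->
  D (average u K) /\ h (average u K) <= K%:R^-1 * \sum_(1 <= k < K.+1) h (u k).
Proof.
move=> + hc Du; case: K => // K _; elim: K => [|K [IHD IH]].
  by rewrite /average !big_nat1 invr1 scale1r mul1r.
have K0 : 0 < K.+2%:R :> R by rewrite ltr0n.
have t01 : 0 <= (K.+2%:R^-1 : R) <= 1.
  by rewrite invr_ge0 ltW//= invf_le1// ler1n.
have [D1 h1] := hc _ _ _ t01 (Du K.+1) IHD.
rewrite averageS; split => //; apply: le_trans h1 _.
rewrite [in leRHS]big_nat_recr//= mulrDr addrC lerD2r.
apply: (@le_trans _ _ ((1 - K.+2%:R^-1) * (K.+1%:R^-1 * \sum_(1 <= k < K.+2) h (u k)))).
  by rewrite ler_wpM2l// subr_ge0; case/andP: t01.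
by rewrite mulrA average_weight.
Qed.

Lemma inner_average (R : realType) (N : nat) (w : 'cV[R]_N)
    (u : nat -> 'cV[R]_N) (K : nat) :
  inner (average u K) w = K%:R^-1 * \sum_(1 <= k < K.+1) inner (u k) w.
Proof. by rewrite /average innerZl inner_suml. Qed.

(** The variational inequality of a proximal point, obtained by comparing xb with
    t z + (1 - t) xb: the convexity gap is of order t, the error of order t^2. *)
Lemma prox_vi (R : realType) (N : nat) (M : 'M[R]_N) (D : 'cV[R]_N -> Prop)
    (h : 'cV[R]_N -> R) (v xb : 'cV[R]_N) :
  M^T = M -> convex_on D h -> D xb ->
  (forall z, D z ->
    h xb + 2^-1 * sqnorm M (xb - v) <= h z + 2^-1 * sqnorm M (z - v)) ->
  forall z, D z -> h xb - h z <= inner (M *m (xb - v)) (z - xb).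
Proof.
move=> Ms hc Db bmin z Dz; rewrite -subr_le0.
apply: (@le0_of_small_multiples _ _ (2^-1 * sqnorm M (z - xb))) => t /andP[t0 t1].
have t01 : 0 <= t <= 1 by rewrite ltW.
have [D1 h1] := hc _ _ _ t01 Dz Db.
have := le_trans (bmin _ D1) (lerD h1 (lexx _)).
rewrite (_ : t *: z + (1 - t) *: xb - v = (xb - v) + t *: (z - xb)); last first.
  by apply/colP => i; rewrite !mxE; ring.
rewrite (sqnorm_symD _ (t *: _) Ms) sqnormZ innerZr.
set A := h xb; set B := sqnorm M (xb - v); set I := inner _ _; set S := sqnorm _ _.
move=> H.
rewrite -(ler_pM2l t0).
by move: H; rewrite expr2; lra.
Qed.

(** The dual step is the proximal step of a linear function, so the variational
    inequality holds in all directions and forces equality. *)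
Lemma quadratic_argmin (R : realType) (N : nat) (M : 'M[R]_N)
    (y yn b : 'cV[R]_N) : M^T = M ->
  (forall z, 2^-1 * sqnorm M (yn - y) - inner yn b
              <= 2^-1 * sqnorm M (z - y) - inner z b) ->
  M *m (yn - y) = b.
Proof.
move=> Ms ymin; pose h (z : 'cV[R]_N) := - inner z b.
have hc : convex_on (fun=> True) h.
  by move=> u v t _ _ _; split => //; rewrite /h innerDl !innerZl; lra.
have hmin z : True -> h yn + 2^-1 * sqnorm M (yn - y) <= h z + 2^-1 * sqnorm M (z - y).
  by move=> _; have := ymin z; rewrite /h; lra.
have vi := prox_vi Ms hc I hmin.
have [d dE] : exists d, M *m (yn - y) = d + b.
  by exists (M *m (yn - y) - b); rewrite subrK.
suff d0 : d = 0 by rewrite dE d0 add0r.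
apply/inner_eq0/le_anti; rewrite inner_ge0 andbT.
have := vi (yn - d) I; rewrite dE (_ : yn - d - yn = - d).
  by rewrite /h !(innerDl, innerNl, innerNr) (innerC d b); lra.
by rewrite addrAC subrr add0r.
Qed.

Lemma convex_functionP (R : realType) (n : nat) (f : 'cV[R]_n -> R) :
  convex_function [set: 'cV[R]_n] f -> convex_on (fun=> True) f.
Proof.
move=> fc u v t /andP[t0 t1] _ _; split => //.
by have := fc (Itv01 t0 t1) u v (in_setT _) (in_setT _); rewrite convRE.
Qed.

(** * Gradients of smooth convex functions *)

Lemma cV_sum_delta (R : realType) (N : nat) (h : 'cV[R]_N) :
  h = \sum_i h i 0 *: delta_mx i 0.
Proof.
apply/colP => i; rewrite summxE (bigD1 i)//= !mxE !eqxx mulr1.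
by rewrite big1 ?addr0// => j ji; rewrite !mxE eq_sym (negPf ji) mulr0.
Qed.

Lemma derive_grad (R : realType) (n : nat) (f : 'cV[R]_n -> R)
    (x h : 'cV[R]_n) :
  differentiable f x -> 'D_h f x = inner (grad f x) h.
Proof.
move=> df; rewrite deriveE//.
rewrite {1}(cV_sum_delta h).
rewrite linear_sum; apply: eq_bigr => i _.
by rewrite linearZ/= !mxE deriveE// mulrC.
Qed.

(** The difference quotients along z - x are at most f z - f x by convexity, and
    they converge to the directional derivative. *)
Lemma convex_gradient_ineq (R : realType) (n : nat) (f : 'cV[R]_n -> R)
    (x z : 'cV[R]_n) :
  convex_on (fun=> True) f -> differentiable f x ->
  f x + inner (grad f x) (z - x) <= f z.
Proof.
move=> fc df; rewrite addrC -lerBrDr -derive_grad//.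
have /cvg_dnbhs_at_right := diff_derivable (v := z - x) df.
move=> /cvgr_to_le; apply.
near=> t.
have t0 : 0 < t by near: t; exact: nbhs_right_gt.
have t1 : t <= 1 by near: t; exact: nbhs_right_le.
have t01 : 0 <= t <= 1 by rewrite ltW.
have [_] := fc z x t t01 I I.
rewrite (_ : t *: z + (1 - t) *: x = t *: (z - x) + x); last first.
  by apply/colP => i; rewrite !mxE; ring.
move=> h; rewrite /= [_ *: _]mulrC ler_pdivrMr//; lra.
Unshelve. all: end_near. Qed.

Lemma is_derive_line (R : realType) (n : nat) (f : 'cV[R]_n -> R)
    (x d : 'cV[R]_n) (t : R) : differentiable f (x + t *: d) ->
  is_derive t 1 (fun s : R => f (x + s *: d)) (inner (grad f (x + t *: d)) d).
Proof.
move=> df.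
have E : (fun h : R => h^-1 *: (f (x + (h *: 1 + t) *: d) - f (x + t *: d))) =
         (fun h : R => h^-1 *: (f (h *: d + (x + t *: d)) - f (x + t *: d))).
  apply/funext => h; congr (_ *: (f _ - _)).
  by rewrite scalerDl [h *: 1]mulr1 addrCA.
apply: DeriveDef; first by rewrite /derivable/= E; exact: diff_derivable.
by rewrite -derive_grad// /derive/= E.
Qed.

(** The descent lemma.  The function psi below, f along the segment minus its
    quadratic upper model, has nonpositive derivative by Cauchy-Schwarz and the
    Lipschitz bound, so the mean value theorem gives psi 1 <= psi 0. *)
Lemma descent_lemma (R : realType) (n : nat) (f : 'cV[R]_n -> R) (L : R)
    (x d : 'cV[R]_n) :
  (forall z, differentiable f z) ->
  (forall u v, norm2 (grad f u - grad f v) <= L * norm2 (u - v)) ->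
  f (x + d) <= f x + inner (grad f x) d + L / 2 * inner d d.
Proof.
move=> df Lf.
pose a := inner (grad f x) d; pose q := L * inner d d.
pose psi (s : R) : R := f (x + s *: d) - (s * a + 2^-1 * q * s ^+ 2).
pose dpsi (t : R) : R := inner (grad f (x + t *: d)) d - (a + q * t).
have psiD (t : R) : is_derive t 1 psi (dpsi t).
  apply: is_deriveB; first exact: is_derive_line.
  have idD := @is_derive_id R R t 1.
  have aD := is_deriveM idD (is_derive_cst a t 1).
  have qD := is_deriveM (is_derive_cst (2^-1 * q) t 1) (is_deriveX 2 idD).
  by apply: (is_derive_eq (is_deriveD aD qD)); rewrite /GRing.scale/=; lra.
have [c /andP[c0 _] E] := @MVT_segment R psi dpsi 0 1 ler01 (fun t _ => psiD t)
  (derivable_within_continuous (fun t _ => @ex_derive _ _ _ _ _ _ _ (psiD t))).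
have c0' : 0 <= c by move: c0; rewrite bnd_simp.
have : psi 1 - psi 0 <= 0.
  rewrite E subr0 mulr1 /dpsi subr_le0 -lerBlDl.
  rewrite /a -innerNl -innerDl.
  apply: le_trans (inner_le_norm2 _ _) _.
  apply: le_trans (ler_wpM2r (norm2_ge0 _) (Lf _ _)) _.
  rewrite addrAC subrr add0r norm2Z ger0_norm// /q -norm2_sqr.
  by rewrite le_eqVlt; apply/orP; left; apply/eqP; ring.
by rewrite /psi /q scale1r scale0r addr0 -/a; lra.
Qed.

(** The gradient may be taken at a third point x: the descent lemma bounds
    f z - f x, convexity bounds f x - f u. *)
Lemma smooth_convex_three_point (R : realType) (n : nat) (f : 'cV[R]_n -> R) (L : R)
    (x z u : 'cV[R]_n) :
  convex_on (fun=> True) f -> (forall z, differentiable f z) ->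
  (forall u v, norm2 (grad f u - grad f v) <= L * norm2 (u - v)) ->
  f z - f u <= inner (grad f x) (z - u) + L / 2 * inner (z - x) (z - x).
Proof.
move=> fc df Lf.
have := descent_lemma x (z - x) df Lf; rewrite subrKC.
have := convex_gradient_ineq u fc (df x).
rewrite !innerDr !innerNr; lra.
Qed.

(** The gradient of the separable sum is that of the f_i on the first blocks and 0
    elsewhere; testing it against h avoids assembling that block vector.  Each
    block is a linear image of x, so the chain rule is an equality of difference
    quotients. *)
Lemma inner_grad_Fsum (R : realType) (m n p : nat) (f : 'I_m -> 'cV[R]_n -> R)
    (x h : 'cV[R]_(liftdim m n p)) :
  (forall i z, differentiable (f i) z) ->
  inner (grad (Fsum f) x) h =
    \sum_i inner (grad (f i) (blk (usubmx x) i)) (blk (usubmx h) i).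
Proof.
move=> df.
pose l i (z : 'cV[R]_(liftdim m n p)) : 'cV[R]_n := blk (usubmx z) i.
have lD i u v : l i (u + v) = l i u + l i v by rewrite /l linearD blkD.
have lZ i a v : l i (a *: v) = a *: l i v by rewrite /l linearZ blkZ.
have D i v : is_derive x v (fun z => f i (l i z)) (inner (grad (f i) (l i x)) (l i v)).
  have E : (fun h : R => h^-1 *: (f i (l i (h *: v + x)) - f i (l i x))) =
           (fun h : R => h^-1 *: (f i (h *: l i v + l i x) - f i (l i x))).
    by apply/funext => t; rewrite lD lZ.
  apply: DeriveDef; first by rewrite /derivable/= E; exact: diff_derivable.
  by rewrite -derive_grad// /derive/= E.
have DF v : 'D_v (Fsum f) x = \sum_i inner (grad (f i) (l i x)) (l i v).
  have -> : Fsum f = \sum_i (fun z => f i (l i z)).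
    by apply/funext => z; rewrite fct_sumE.
  apply: derive_val; exact: is_derive_sum.
rewrite {1}/inner; under eq_bigr do rewrite mxE DF mulr_suml.
rewrite exchange_big; apply: eq_bigr => i _ /=.
under eq_bigr do rewrite mulrC -innerZr -lZ.
rewrite -inner_sumr -/(l i h); congr (inner _ _).
rewrite [in RHS](cV_sum_delta h).
have l0 : l i 0 = 0 by rewrite -[0 in LHS](scale0r 0) lZ scale0r.
by rewrite (big_morph _ (lD i) l0).
Qed.

(** * The primal-dual inequality *)

(** Young's inequality: expand the squared norm of Gam s - z in the metric Gi,
    using that Gam is the inverse of Gi. *)
Lemma dual_metric_young (R : realType) (N : nat) (Gi Gam : 'M[R]_N) (s z : 'cV[R]_N) :
  Gi^T = Gi -> Gi *m Gam = 1%:M -> (forall w, 0 <= sqnorm Gi w) ->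
  inner s z <= 2^-1 * sqnorm Gam s + 2^-1 * sqnorm Gi z.
Proof.
move=> Gs GG Gp; have := Gp (Gam *m s + - z).
rewrite (sqnorm_symD _ (- z) Gs) sqnormN innerNr mulmxA GG mul1mx.
have -> : sqnorm Gi (Gam *m s) = sqnorm Gam s.
  by rewrite /sqnorm mulmxA GG mul1mx innerC.
lra.
Qed.

Definition lagr (R : realType) (N : nat) (B : 'M[R]_N) (phi : 'cV[R]_N -> R)
  (x y : 'cV[R]_N) : R := phi x + inner y (B *m x).

(** One iteration, for an arbitrary primal-dual prediction-correction scheme.  The
    prediction xb is compared with xn and xn is compared with u; the vector g, the
    gradient at x, cancels after adding the bound on F, and the only term left
    besides squared norms is <B^T (y - yn), xn - xb>, absorbed by the two negative
    squares through Young's inequality and the domination of B Gam B^T by Q. *)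
Lemma pd_step (R : realType) (N : nat) (Gi Gam Q B : 'M[R]_N)
    (D : 'cV[R]_N -> Prop) (F h : 'cV[R]_N -> R)
    (g x y xb xn yn : 'cV[R]_N) :
  Gi^T = Gi -> Gi *m Gam = 1%:M -> (forall w, 0 <= sqnorm Gi w) -> Q^T = Q ->
  (forall w, sqnorm Gam (B^T *m w) <= sqnorm Q w) ->
  (forall z u, F z - F u <= inner g (z - u) + 2^-1 * sqnorm Gi (z - x)) ->
  convex_on D h -> D xb -> D xn ->
  (forall w, D w ->
    h xb + 2^-1 * sqnorm Gi (xb - (x - Gam *m g - Gam *m (B^T *m y)))
    <= h w + 2^-1 * sqnorm Gi (w - (x - Gam *m g - Gam *m (B^T *m y)))) ->
  (forall w, D w ->
    h xn + 2^-1 * sqnorm Gi (xn - (x - Gam *m g - Gam *m (B^T *m yn)))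
    <= h w + 2^-1 * sqnorm Gi (w - (x - Gam *m g - Gam *m (B^T *m yn)))) ->
  Q *m (yn - y) = B *m xb ->
  forall u v, D u ->
  lagr B (fun z => F z + h z) xb v - lagr B (fun z => F z + h z) u yn <=
    2^-1 * ((sqnorm Gi (u - x) + sqnorm Q (v - y))
            - (sqnorm Gi (u - xn) + sqnorm Q (v - yn))).
Proof.
move=> Gs GG Gp Qs BQ Fle hc Db Dn bmin nmin yE u v Du.
(* The metric Gi undoes the preconditioner Gam inside the proximal point. *)
have shift z w : Gi *m (z - (x - Gam *m g - Gam *m (B^T *m w)))
    = Gi *m (z - x) + g + B^T *m w.
  by rewrite !opprD !opprK !addrA !mulmxDr !mulmxN !mulmxA GG !mul1mx.
have vib := prox_vi Gs hc Db bmin Dn; rewrite shift !innerDl in vib.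
have vin := prox_vi Gs hc Dn nmin Du; rewrite shift !innerDl in vin.
rewrite (inner_polarization _ _ _ Gs) in vib.
rewrite (inner_polarization _ _ _ Gs) in vin.
have F1 := Fle xb u.
have yo := dual_metric_young (B^T *m (y - yn)) (xn - xb) Gs GG Gp.
have bq := BQ (y - yn).
have ye : inner v (B *m xb) - inner yn (B *m xb)
    = 2^-1 * (sqnorm Q (v - y) - sqnorm Q (v - yn) - sqnorm Q (yn - y)).
  by rewrite -(inner_polarization _ _ _ Qs) yE innerDr innerNr !(innerC (B *m _)).
have yy : sqnorm Q (y - yn) = sqnorm Q (yn - y) by rewrite -sqnormN opprB.
have e1 : inner yn (B *m xb) = inner (B^T *m yn) xb by rewrite inner_adj.
have e2 : inner yn (B *m u) = inner (B^T *m yn) u by rewrite inner_adj.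
have e3 : inner (B^T *m (y - yn)) (xn - xb)
    = inner (B^T *m y) xn - inner (B^T *m y) xb
      - (inner (B^T *m yn) xn - inner (B^T *m yn) xb).
  by rewrite mulmxBr innerDl innerNl !innerDr !innerNr.
rewrite !innerDr !innerNr in vib; rewrite !innerDr !innerNr in vin.
rewrite !innerDr !innerNr in F1.
rewrite /lagr; lra.
Qed.

Lemma pd_gap (R : realType) (N : nat) (Gi Q B : 'M[R]_N)
    (D : 'cV[R]_N -> Prop) (phi : 'cV[R]_N -> R) (xb x y : nat -> 'cV[R]_N) :
  (forall w, 0 <= sqnorm Gi w) -> (forall w, 0 <= sqnorm Q w) ->
  convex_on D phi -> (forall k, D (xb k.+1)) ->
  (forall k u v, D u -> lagr B phi (xb k.+1) v - lagr B phi u (y k.+1) <=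
    2^-1 * ((sqnorm Gi (u - x k) + sqnorm Q (v - y k))
            - (sqnorm Gi (u - x k.+1) + sqnorm Q (v - y k.+1)))) ->
  forall K, (1 <= K)%N -> D (average xb K) /\
  forall u v, D u ->
  lagr B phi (average xb K) v - lagr B phi u (average y K) <=
    K%:R^-1 * (2^-1 * (sqnorm Gi (u - x 0%N) + sqnorm Q (v - y 0%N))).
Proof.
move=> Gp Qp phic Db step K K1; split; first exact: (jensen_average K1 phic Db).1.
move=> u v Du.
have vc : convex_on D (lagr B phi ^~ v).
  apply: (convex_onD phic) => a b t t01 Da Db'.
  have [Dt _] := phic a b t t01 Da Db'; split=> //.
  by rewrite mulmxDr -!scalemxAr innerDr !innerZr.
have [_ Xle] := jensen_average K1 vc Db.
have K0 : 0 < K%:R :> R by rewrite ltr0n.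
have uE : lagr B phi u (average y K)
    = K%:R^-1 * \sum_(1 <= k < K.+1) lagr B phi u (y k).
  rewrite /lagr inner_average big_split/= mulrDr; congr (_ + _).
  by rewrite big_const_nat subn1/= iter_addr_0 -[phi u *+ K]mulr_natl mulKf// gt_eqF.
have tele : \sum_(1 <= k < K.+1) (lagr B phi (xb k) v - lagr B phi u (y k)) <=
    2^-1 * ((sqnorm Gi (u - x 0%N) + sqnorm Q (v - y 0%N))
            - (sqnorm Gi (u - x K) + sqnorm Q (v - y K))).
  elim: {K1 Xle K0 uE} K => [|K IH]; first by rewrite big_nil subrr mulr0.
  by rewrite big_nat_recr//=; have := step K u v Du; lra.
rewrite uE; apply: le_trans (lerB Xle (lexx _)) _.
rewrite -mulrBr -sumrB; apply: ler_wpM2l; first by rewrite invr_ge0 ltW.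
apply: le_trans tele _; have := Gp (u - x K); have := Qp (v - y K); lra.
Qed.

(** A crude bound of a quadratic form on the unit ball: only some constant is
    needed, since the rates do not track it. *)
Lemma sqnorm_le_norm1 (R : realType) (N : nat) (Q : 'M[R]_N) (s : 'cV[R]_N) :
  norm2 s <= 1 -> sqnorm Q s <= \sum_i \sum_j `|Q i j|.
Proof.
move=> s1.
have s1i i : `|s i 0| <= 1.
  rewrite -(ler_pXn2r (_ : 0 < 2)%N) ?nnegrE// expr1n real_normK ?num_real//.
  apply: (@le_trans _ _ (norm2 s ^+ 2)); last by rewrite expr_le1// norm2_ge0.
  rewrite norm2_sqr /inner (bigD1 i)//= -expr2 lerDl.
  by apply: sumr_ge0 => j _; rewrite -expr2 sqr_ge0.
rewrite /sqnorm /inner; apply: ler_sum => i _; rewrite mxE mulr_sumr.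
apply: ler_sum => j _; apply: le_trans (ler_norm _) _.
rewrite !normrM mulrCA -[leRHS]mulr1 ler_wpM2l//.
by rewrite -[leRHS]mulr1 ler_pM.
Qed.

(** The gap bound holds for every dual point v.  Choosing v at unit distance from
    ys in the direction of B (X K) makes the optimality gap at ys, which is
    nonnegative, plus |B (X K)| bounded by C / K. *)
Lemma pd_rates (R : realType) (N : nat) (Q B : 'M[R]_N) (D : 'cV[R]_N -> Prop)
    (phi : 'cV[R]_N -> R) (X : nat -> 'cV[R]_N) (xs ys y0 : 'cV[R]_N) (c : R) :
  Q^T = Q -> (forall w, 0 <= sqnorm Q w) -> 0 <= c -> B *m xs = 0 ->
  (forall x, D x -> lagr B phi xs ys <= lagr B phi x ys) ->
  (forall K, (1 <= K)%N -> D (X K)) ->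
  (forall K v, (1 <= K)%N -> phi (X K) + inner v (B *m X K) - phi xs
    <= K%:R^-1 * (2^-1 * (c + sqnorm Q (v - y0)))) ->
  (exists C, forall K, (1 <= K)%N -> norm2 (B *m X K) <= C / K%:R)
  /\ (exists C, forall K, (1 <= K)%N -> `|phi (X K) - phi xs| <= C / K%:R).
Proof.
move=> Qs Qp c0 Bxs opt DX gap.
have low K : (1 <= K)%N -> 0 <= phi (X K) + inner ys (B *m X K) - phi xs.
  by move=> K1; have := opt _ (DX K K1); rewrite /lagr Bxs inner0r; lra.
pose q := \sum_i \sum_j `|Q i j|.
have q0 : 0 <= q by apply: sumr_ge0 => i _; apply: sumr_ge0.
pose C1 := 2^-1 * (c + (2 * sqnorm Q (ys - y0) + 2 * q)).
have C10 : 0 <= C1.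
  by rewrite /C1; have := Qp (ys - y0); have := q0; have := c0; lra.
have B1 K : (1 <= K)%N -> norm2 (B *m X K) <= C1 / K%:R.
  move=> K1; have K0 : 0 < K%:R :> R by rewrite ltr0n.
  have [->|n0] := eqVneq (norm2 (B *m X K)) 0; first by rewrite divr_ge0// ltW.
  pose s := (norm2 (B *m X K))^-1 *: (B *m X K).
  have s1 : norm2 s <= 1.
    by rewrite norm2Z ger0_norm ?invr_ge0 ?norm2_ge0// mulVf.
  have sB : inner s (B *m X K) = norm2 (B *m X K).
    by rewrite innerZl -norm2_sqr expr2 mulKf.
  have := gap K (ys + s) K1; rewrite innerDl sB => g1.
  have Qle : sqnorm Q (ys + s - y0) <= 2 * sqnorm Q (ys - y0) + 2 * q.
    rewrite addrAC; move: (ys - y0) => a; have := Qp (a - s); have := sqnorm_le_norm1 Q s1.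
    rewrite !(sqnorm_symD _ _ Qs) sqnormN innerNr -/q; lra.
  apply: (@le_trans _ _ (K%:R^-1 * (2^-1 * (c + sqnorm Q (ys + s - y0))))).
    by have := low K K1; lra.
  rewrite mulrC; apply: ler_wpM2r; first by rewrite invr_ge0 ltW.
  by rewrite /C1; lra.
split; first by exists C1.
(* The first summand is the upper bound, from v = 0; the second is the lower
   bound, from optimality of xs and the bound on B (X K). *)
exists (2^-1 * (c + sqnorm Q (0 - y0)) + norm2 ys * C1) => K K1.
have K0 : 0 <= K%:R^-1 :> R by rewrite invr_ge0.
have up := gap K 0 K1.
rewrite innerC inner0r addr0 in up.
have dn : - (norm2 ys * (C1 / K%:R)) <= phi (X K) - phi xs.
  have := low K K1; have := inner_le_norm2 ys (B *m X K).
  have := ler_wpM2l (norm2_ge0 ys) (B1 K K1); lra.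
have p1 : 0 <= norm2 ys * (C1 / K%:R) by rewrite mulr_ge0 ?norm2_ge0// mulr_ge0.
have p2 : 0 <= K%:R^-1 * (2^-1 * (c + sqnorm Q (0 - y0))).
  by rewrite mulr_ge0// mulr_ge0 ?invr_ge0 ?addr_ge0.
rewrite ler_norml; apply/andP; split; lra.
Qed.

(** * Extended-valued functions and saddle points *)

Definition domG (R : realType) (m n p : nat) (g : 'I_m -> 'cV[R]_p -> \bar R)
    (x : 'cV[R]_(liftdim m n p)) : Prop :=
  forall i, g i (blk (dsubmx x) i) \is a fin_num.

Definition fineG (R : realType) (m n p : nat) (g : 'I_m -> 'cV[R]_p -> \bar R)
    (x : 'cV[R]_(liftdim m n p)) : R :=
  \sum_i fine (g i (blk (dsubmx x) i)).

Lemma GsumE (R : realType) (m n p : nat) (g : 'I_m -> 'cV[R]_p -> \bar R)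
    (x : 'cV[R]_(liftdim m n p)) : domG g x -> Gsum g x = (fineG g x)%:E.
Proof.
move=> Dx; rewrite /fineG -sumEFin; apply: eq_bigr => i _.
by rewrite fineK//; exact: Dx.
Qed.

(** Properness excludes the value -oo, so that one infinite summand suffices. *)
Lemma Gsum_pinfty (R : realType) (m n p : nat) (g : 'I_m -> 'cV[R]_p -> \bar R)
    (x : 'cV[R]_(liftdim m n p)) : (forall i, proper_fun (g i)) ->
  ~ domG g x -> Gsum g x = +oo%E.
Proof.
move=> gp /existsNP[i gi]; apply/esum_eqyP; first by move=> j _; case: (gp j).
exists i; split; rewrite ?mem_index_enum//.
by move: gi; have [+ _] := gp i; move/(_ (blk (dsubmx x) i)); case: (g i _).
Qed.

Lemma domG_nonempty (R : realType) (m n p : nat)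
    (g : 'I_m -> 'cV[R]_p -> \bar R) : (forall i, proper_fun (g i)) ->
  exists x : 'cV[R]_(liftdim m n p), domG g x.
Proof.
move=> gp; have /choice[z zP] : forall i, exists z, g i z \is a fin_num.
  move=> i; have [gN [z zy]] := gp i; exists z.
  by rewrite fin_numE gN lt_eqF.
by exists (col_mx 0 (\mxcol_i z i)) => i; rewrite col_mxKd blk_mxcol.
Qed.

Lemma convex_fineG (R : realType) (m n p : nat)
    (g : 'I_m -> 'cV[R]_p -> \bar R) : (forall i, proper_fun (g i)) ->
  (forall i, convex_efun (g i)) ->
  convex_on (domG g) (@fineG R m n p g).
Proof.
move=> gp gc u v t t01 Du Dv.
have key i : g i (blk (dsubmx (t *: u + (1 - t) *: v)) i) \is a fin_num /\
    fine (g i (blk (dsubmx (t *: u + (1 - t) *: v)) i)) <=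
    t * fine (g i (blk (dsubmx u) i)) + (1 - t) * fine (g i (blk (dsubmx v) i)).
  rewrite linearD/= !linearZ/= blkD !blkZ.
  have := gc i (blk (dsubmx u) i) (blk (dsubmx v) i) t t01.
  rewrite -(fineK (Du i)) -(fineK (Dv i)) -!EFinM -EFinD.
  have [+ _] := gp i => /(_ (t *: blk (dsubmx u) i + (1 - t) *: blk (dsubmx v) i)).
  by case: (g i _).
split; first by move=> i; exact: (key i).1.
apply: le_trans (ler_sum _ (fun i _ => (key i).2)) _.
by rewrite big_split /fineG !mulr_sumr.
Qed.

Lemma convex_Fsum (R : realType) (m n p : nat) (f : 'I_m -> 'cV[R]_n -> R)
    (D : 'cV[R]_(liftdim m n p) -> Prop) (h : 'cV[R]_(liftdim m n p) -> R) :
  (forall i, convex_on (fun=> True) (f i)) -> convex_on D h ->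
  convex_on D (fun x => Fsum f x + h x).
Proof.
move=> fc hc; suff Fc : convex_on D (Fsum f) by apply: (convex_onD Fc).
move=> u v t t01 Du Dv; have [Dt _] := hc u v t t01 Du Dv; split => //.
have key i : f i (blk (usubmx (t *: u + (1 - t) *: v)) i)
    <= t * f i (blk (usubmx u) i) + (1 - t) * f i (blk (usubmx v) i).
  by rewrite linearD/= !linearZ/= blkD !blkZ; exact: (fc i _ _ t t01 I I).2.
apply: le_trans (ler_sum _ (fun i _ => key i)) _.
by rewrite big_split /Fsum !mulr_sumr.
Qed.

Lemma LagrangianE (R : realType) (m n p : nat) (f : 'I_m -> 'cV[R]_n -> R)
    (g : 'I_m -> 'cV[R]_p -> \bar R) (W : 'M[R]_m) (U : 'I_m -> 'M[R]_(p, n))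
    (x y : 'cV[R]_(liftdim m n p)) : domG g x ->
  Lagrangian f g W U x y
    = (lagr (Bmx W U) (fun z => Fsum f z + fineG g z) x y)%:E.
Proof. by move=> Dx; rewrite /Lagrangian (GsumE Dx). Qed.

Lemma Lagrangian_pinfty (R : realType) (m n p : nat) (f : 'I_m -> 'cV[R]_n -> R)
    (g : 'I_m -> 'cV[R]_p -> \bar R) (W : 'M[R]_m) (U : 'I_m -> 'M[R]_(p, n))
    (x y : 'cV[R]_(liftdim m n p)) : (forall i, proper_fun (g i)) ->
  ~ domG g x -> Lagrangian f g W U x y = +oo%E.
Proof. by move=> gp Dx; rewrite /Lagrangian Gsum_pinfty. Qed.

(** A proximal point lies in the domain because some point does. *)
Lemma prox_fineG (R : realType) (m n p : nat) (g : 'I_m -> 'cV[R]_p -> \bar R)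
    (M : 'M[R]_(liftdim m n p)) (v xb : 'cV[R]_(liftdim m n p)) :
  (forall i, proper_fun (g i)) -> prox M (Gsum g) v xb ->
  domG g xb /\ forall z, domG g z ->
    fineG g xb + 2^-1 * sqnorm M (xb - v) <= fineG g z + 2^-1 * sqnorm M (z - v).
Proof.
move=> gp xbP.
have Db : domG g xb.
  apply: contrapT => ND; have [z Dz] := @domG_nonempty R m n p g gp.
  by have := xbP z; rewrite (Gsum_pinfty gp ND) (GsumE Dz).
split=> // z Dz; have := xbP z.
by rewrite (GsumE Db) (GsumE Dz) -!EFinD lee_fin.
Qed.

(** The constants L_i are replaced by 1 / tau_i and the second block is added for
    free, so that the quadratic term is measured in the metric Gamma^-1. *)
Lemma Fsum_three_point (R : realType) (m n p : nat)
    (f : 'I_m -> 'cV[R]_n -> R) (L tau : 'I_m -> R)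
    (x z u : 'cV[R]_(liftdim m n p)) :
  (forall i, convex_on (fun=> True) (f i)) ->
  (forall i z, differentiable (f i) z) ->
  (forall i u v, norm2 (grad (f i) u - grad (f i) v) <= L i * norm2 (u - v)) ->
  (forall i, 0 < tau i) -> (forall i, L i <= (tau i)^-1) ->
  Fsum f z - Fsum f u <= inner (grad (Fsum f) x) (z - u)
    + 2^-1 * sqnorm (Gammamx n p (fun i => (tau i)^-1)) (z - x).
Proof.
move=> fc df Lf t0 Lt.
rewrite inner_grad_Fsum// sqnorm_Gammamx.
have p0 : 0 <= inner (dsubmx (z - x))
    (diag_tau (fun i => (tau i)^-1) p *m dsubmx (z - x)).
  by apply: diag_tau_ge0 => i; rewrite invr_ge0 ltW.
suff : Fsum f z - Fsum f u <=
    \sum_i inner (grad (f i) (blk (usubmx x) i)) (blk (usubmx (z - u)) i)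
    + 2^-1 * inner (usubmx (z - x)) (diag_tau (fun i => (tau i)^-1) n *m usubmx (z - x)).
  by move: p0; lra.
have key i : f i (blk (usubmx z) i) - f i (blk (usubmx u) i) <=
    inner (grad (f i) (blk (usubmx x) i)) (blk (usubmx (z - u)) i) +
    2^-1 * ((tau i)^-1 * inner (blk (usubmx (z - x)) i) (blk (usubmx (z - x)) i)).
  have bB (a b : 'cV[R]_(liftdim m n p)) :
      blk (usubmx (a - b)) i = blk (usubmx a) i - blk (usubmx b) i.
    by rewrite linearB/= blkD blkN.
  rewrite !bB.
  have := smooth_convex_three_point (blk (usubmx x) i)
    (blk (usubmx z) i) (blk (usubmx u) i)
    (fc i) (df i) (Lf i).
  have := ler_wpM2r (inner_ge0 (blk (usubmx z) i - blk (usubmx x) i)) (Lt i).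
  by lra.
rewrite inner_diag_tau mulr_sumr -big_split/= /Fsum -sumrB.
by apply: ler_sum => i _; exact: key.
Qed.

Lemma sqnorm_Hmx (R : realType) (m n p : nat) (U : 'I_m -> 'M[R]_(p, n))
    (tau : 'I_m -> R) (beta : R) (a b : 'cV[R]_(liftdim m n p)) :
  sqnorm (Hmx U tau beta) (col_mx a b) =
    sqnorm (invmx (Gammamx n p tau)) a + sqnorm (Qmx U tau beta) b.
Proof. by rewrite /sqnorm mul_block_col !mul0mx addr0 add0r inner_col_mx. Qed.

Lemma Bmx_mul (R : realType) (m n p : nat) (W : 'M[R]_m)
    (U : 'I_m -> 'M[R]_(p, n)) (x : 'cV[R]_(liftdim m n p)) :
  Bmx W U *m x = col_mx (mxsqrt (Vmx n W) *m usubmx x)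
                        (Umx U *m usubmx x - dsubmx x).
Proof.
by rewrite -{1}(vsubmxK x) mul_block_col mul0mx addr0 mulNmx mul1mx.
Qed.

(** The kernel of B encodes the constraints of the consensus problem: all primal
    blocks agree and the second blocks are their images under the U_i. *)
Lemma Bmx_eq0P (R : realType) (m n p : nat) (e : rel 'I_m) (W : 'M[R]_m)
    (U : 'I_m -> 'M[R]_(p, n)) (x : 'cV[R]_(liftdim m n p)) :
  mixing_matrix e W ->
  Bmx W U *m x = 0 <-> exists c, forall i,
    blk (usubmx x) i = c /\ blk (dsubmx x) i = U i *m c.
Proof.
move=> mW; have [Cs CC] := mxsqrt_root (Vmx_psd_root n mW).
rewrite Bmx_mul; split.
- move=> /eqP; rewrite col_mx_eq0 => /andP[/eqP V0 /eqP D0].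
  have /(Vmx_consensus _ mW)[c cE] : Vmx n W *m usubmx x = 0.
    by rewrite -CC -mulmxA V0 mulmx0.
  exists c => i; split=> //.
  by rewrite -(cE i) -blk_Umx; congr (blk _ i); apply/esym/eqP; rewrite -subr_eq0 D0.
- move=> [c cE]; apply/eqP; rewrite col_mx_eq0; apply/andP; split; apply/eqP.
    apply/norm2_eq0/eqP; rewrite -sqrf_eq0 (norm2_root _ Cs CC).
    have -> : Vmx n W *m usubmx x = 0.
      by apply/(Vmx_consensus _ mW); exists c => i; exact: (cE i).1.
    by rewrite inner0r.
  apply/eqP; rewrite subr_eq0; apply/eqP/eq_blk => i.
  by rewrite blk_Umx (cE i).1 (cE i).2.
Qed.

(** On the kernel of B the lifted objective is the original one. *)
Lemma objective_lift (R : realType) (m n p : nat) (f : 'I_m -> 'cV[R]_n -> R)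
    (g : 'I_m -> 'cV[R]_p -> \bar R) (U : 'I_m -> 'M[R]_(p, n))
    (x : 'cV[R]_(liftdim m n p)) (c : 'cV[R]_n) :
  (forall i, blk (usubmx x) i = c /\ blk (dsubmx x) i = U i *m c) ->
  objective f g U c = ((Fsum f x)%:E + Gsum g x)%E.
Proof.
move=> cE; rewrite /objective /Fsum /Gsum -sumEFin -big_split/=.
by apply: eq_bigr => i _; rewrite (cE i).1 (cE i).2.
Qed.

(** Maximality in y at the point ys + B xs gives |B xs|^2 <= 0. *)
Lemma saddle_lagr (R : realType) (m n p : nat) (e : rel 'I_m) (W : 'M[R]_m)
    (U : 'I_m -> 'M[R]_(p, n)) (f : 'I_m -> 'cV[R]_n -> R)
    (g : 'I_m -> 'cV[R]_p -> \bar R) (xs ys : 'cV[R]_(liftdim m n p)) :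
  mixing_matrix e W -> (forall i, proper_fun (g i)) ->
  saddle_point (Lagrangian f g W U) xs ys ->
  let phi z := Fsum f z + fineG g z in
  [/\ domG g xs, Bmx W U *m xs = 0
    & forall x, domG g x -> lagr (Bmx W U) phi xs ys <= lagr (Bmx W U) phi x ys].
Proof.
move=> mW gp [s1 s2] phi.
have Ds : domG g xs.
  apply: contrapT => ND; have [x0 D0] := @domG_nonempty R m n p g gp.
  by have := s2 x0; rewrite (Lagrangian_pinfty f W U ys gp ND)
    (LagrangianE f W U ys D0).
split=> //.
- apply/inner_eq0/le_anti; rewrite inner_ge0 andbT.
  have := s1 (ys + Bmx W U *m xs).
  rewrite !(LagrangianE f W U _ Ds) lee_fin /lagr innerDl; lra.
- by move=> x Dx; have := s2 x; rewrite !LagrangianE.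
Qed.

(** A consensus vector lies in the kernel of B, so the objective there is a value
    of the Lagrangian in x at the saddle multiplier, and xs minimizes that. *)
Lemma objective_min (R : realType) (m n p : nat) (e : rel 'I_m) (W : 'M[R]_m)
    (U : 'I_m -> 'M[R]_(p, n)) (f : 'I_m -> 'cV[R]_n -> R)
    (g : 'I_m -> 'cV[R]_p -> \bar R) (xs ys : 'cV[R]_(liftdim m n p)) :
  mixing_matrix e W -> (forall i, proper_fun (g i)) ->
  saddle_point (Lagrangian f g W U) xs ys ->
  range (objective f g U) (Fsum f xs + fineG g xs)%:E
  /\ lbound (range (objective f g U)) (Fsum f xs + fineG g xs)%:E.
Proof.
move=> mW gp sp; have [Ds Bs _] := saddle_lagr mW gp sp.
have JE : (Fsum f xs + fineG g xs)%:E = Lagrangian f g W U xs ys.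
  by rewrite (LagrangianE f W U ys Ds) /lagr Bs inner0r addr0.
split.
  have /(Bmx_eq0P U xs mW)[c cE] := Bs; exists c => //.
  by rewrite (objective_lift f g cE) (GsumE Ds).
move=> _ [z _ <-]; rewrite JE.
pose x : 'cV[R]_(liftdim m n p) :=
  col_mx (\mxcol_(i < m) z) (\mxcol_(i < m) (U i *m z)).
have xE i : blk (usubmx x) i = z /\ blk (dsubmx x) i = U i *m z.
  rewrite col_mxKu col_mxKd; split; first exact: (blk_mxcol (fun=> z)).
  exact: (blk_mxcol (fun i => U i *m z)).
have Bx : Bmx W U *m x = 0 by apply/(Bmx_eq0P U x mW); exists z.
apply: le_trans (sp.2 x) _.
by rewrite (objective_lift f g xE) /Lagrangian Bx inner0r adde0.
Qed.

(** * Convergence of the algorithm *)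

(** The abstract scheme applies with Gi = Gamma^-1; its smoothness hypothesis
    comes from L_i <= 1 / tau_i and its domination hypothesis from the choice of Q. *)
Lemma disa_gap (R : realType) (m n p : nat) (e : rel 'I_m) (W : 'M[R]_m)
    (U : 'I_m -> 'M[R]_(p, n)) (f : 'I_m -> 'cV[R]_n -> R)
    (g : 'I_m -> 'cV[R]_p -> \bar R) (L tau : 'I_m -> R) (beta : R)
    (xbar x y : nat -> 'cV[R]_(liftdim m n p)) :
  mixing_matrix e W ->
  (forall i, convex_on (fun=> True) (f i)) ->
  (forall i z, differentiable (f i) z) ->
  (forall i u v, norm2 (grad (f i) u - grad (f i) v) <= L i * norm2 (u - v)) ->
  (forall i, convex_efun (g i)) -> (forall i, proper_fun (g i)) ->
  0 < beta -> (forall i, 0 < tau i) -> (forall i, L i <= (tau i)^-1) ->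
  (forall i, 0 < tau i * beta < 1) ->
  DISA f g W U tau beta xbar x y ->
  let phi z := Fsum f z + fineG g z in
  forall K, (1 <= K)%N -> domG g (average xbar K) /\
  forall u v, domG g u ->
  lagr (Bmx W U) phi (average xbar K) v - lagr (Bmx W U) phi u (average y K) <=
    K%:R^-1 * (2^-1 * sqnorm (Hmx U tau beta)
                        (col_mx (x 0%N) (y 0%N) - col_mx u v)).
Proof.
move=> mW fc df Lf gc gp b0 t0 Lt tb [_ it] phi.
have GiE := invmx_Gammamx n p t0.
set Gam := Gammamx n p tau in it GiE *.
set Gi := invmx Gam in it GiE *.
have Gs : Gi^T = Gi by rewrite GiE tr_Gammamx.
have GG : Gi *m Gam = 1%:M.
  by rewrite GiE; apply: Gammamx_mul => i; rewrite mulVf// gt_eqF.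
have Gp w : 0 <= sqnorm Gi w.
  by rewrite GiE; apply: Gammamx_ge0 => i; rewrite invr_ge0 ltW.
have Qs := tr_Qmx U tau beta.
have Qp w := Qmx_ge0 U w b0 tb.
have hc := @convex_fineG R m n p g gp gc.
have phic : convex_on (domG g) phi by exact: convex_Fsum.
have Db k : domG g (xbar k.+1) by have [/(prox_fineG gp)[]] := it k.
have step k u v : domG g u ->
    lagr (Bmx W U) phi (xbar k.+1) v - lagr (Bmx W U) phi u (y k.+1) <=
    2^-1 * ((sqnorm Gi (u - x k) + sqnorm (Qmx U tau beta) (v - y k))
     - (sqnorm Gi (u - x k.+1) + sqnorm (Qmx U tau beta) (v - y k.+1))).
  move=> Du; have [/(prox_fineG gp)[_ bmin] ymin /(prox_fineG gp)[Dn nmin]] := it k.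
  have yE : Qmx U tau beta *m (y k.+1 - y k) = Bmx W U *m xbar k.+1.
    apply: quadratic_argmin => // z; have := ymin z; rewrite lee_fin.
    by rewrite -!inner_adj.
  apply: (pd_step Gs GG Gp Qs _ _ hc (Db k) Dn bmin nmin yE v Du).
    by move=> w; exact: (Bmx_Gammamx_le_Qmx U w mW b0 tb).
  by move=> z w; rewrite GiE; exact: Fsum_three_point.
move=> K K1; have [DK gap] := pd_gap Gp Qp phic Db step K1; split => // u v Du.
rewrite opp_col_mx add_col_mx sqnorm_Hmx -[sqnorm _ (x _ - u)]sqnormN.
by rewrite -[sqnorm _ (y _ - v)]sqnormN !opprB; exact: gap.
Qed.

Theorem theorem3 (R : realType) (m n p : nat) (e : rel 'I_m) (W : 'M[R]_m)
    (U : 'I_m -> 'M[R]_(p, n)) (f : 'I_m -> 'cV[R]_n -> R)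
    (g : 'I_m -> 'cV[R]_p -> \bar R) (L tau : 'I_m -> R) (beta : R)
    (xbar x y : nat -> 'cV[R]_(liftdim m n p))
    (graph_e : connected_graph e) (mixing_W : mixing_matrix e W)
    (saddle : exists xs ys, saddle_point (Lagrangian f g W U) xs ys)
    (f_convex : forall i, convex_function [set: 'cV[R]_n] (f i))
    (f_diff : forall i z, differentiable (f i) z)
    (L_gt0 : forall i, 0 < L i)
    (f_smooth : forall i u v,
      norm2 (grad (f i) u - grad (f i) v) <= L i * norm2 (u - v))
    (g_convex : forall i, convex_efun (g i))
    (g_proper : forall i, proper_fun (g i))
    (g_closed : forall i, closed_fun (g i))
    (beta_gt0 : 0 < beta)
    (tau_bound : forall i, 0 < tau i < 1 / L i)
    (tau_beta : forall i, 0 < tau i * beta < 1)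
    (iterates : DISA f g W U tau beta xbar x y) :
  (forall K : nat, (1 <= K)%N -> forall u v : 'cV[R]_(liftdim m n p),
    (Lagrangian f g W U (average xbar K) v
       - Lagrangian f g W U u (average y K)
     <= (1 / (2 * K%:R)
         * sqnorm (Hmx U tau beta) (col_mx (x 0%N) (y 0%N) - col_mx u v))%R%:E)%E)
  /\
  (exists Jstar : \bar R,
    [/\ range (objective f g U) Jstar,
        lbound (range (objective f g U)) Jstar
      & exists C : R, forall K : nat, (1 <= K)%N ->
          (`| \sum_i ((f i (blk (usubmx (average xbar K)) i))%:E
                      + g i (blk (dsubmx (average xbar K)) i)) - Jstar |
           <= (C / K%:R)%:E)%E])
  /\
  (exists C : R, forall K : nat, (1 <= K)%N ->
    norm2 (mxsqrt (kron_id (1%:M - W) n) *m usubmx (average xbar K))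
      <= C / K%:R).
Proof.
have t0 i : 0 < tau i by have /andP[] := tau_bound i.
have Lt i : L i <= (tau i)^-1.
  have /andP[_] := tau_bound i; rewrite ltr_pdivlMr// => h.
  by rewrite -[leRHS]mul1r ler_pdivlMr// mulrC ltW.
have fc i := convex_functionP (f_convex i).
have gap := disa_gap mixing_W fc f_diff f_smooth g_convex g_proper beta_gt0
  t0 Lt tau_beta iterates.
have [xs [ys sp]] := saddle.
have [Ds Bs opt] := saddle_lagr mixing_W g_proper sp.
set phi := (fun z => Fsum f z + fineG g z) in gap opt.
have [rB rphi] : (exists C, forall K, (1 <= K)%N ->
      norm2 (Bmx W U *m average xbar K) <= C / K%:R)
    /\ (exists C, forall K, (1 <= K)%N ->
      `|phi (average xbar K) - phi xs| <= C / K%:R).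
  apply: (@pd_rates _ _ (Qmx U tau beta) (Bmx W U) (domG g) phi _ xs ys (y 0%N)
    (sqnorm (invmx (Gammamx n p tau)) (x 0%N - xs)) _ _ _ Bs opt).
  - exact: tr_Qmx.
  - by move=> w; exact: Qmx_ge0.
  - rewrite (invmx_Gammamx n p t0); apply: Gammamx_ge0 => i.
    by rewrite invr_ge0 ltW.
  - by move=> K K1; exact: (gap K K1).1.
  - move=> K v K1; have := (gap K K1).2 xs v Ds.
    rewrite opp_col_mx add_col_mx sqnorm_Hmx -[sqnorm _ (y _ - v)]sqnormN opprB.
    by rewrite /lagr Bs inner0r addr0.
split; last split.
- move=> K K1 u v; have [DK gK] := gap K K1.
  have [Du|Du] := pselect (domG g u); last first.
    (* Outside the domain the left-hand side is -oo, since the average of the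
       predictions always has a finite value. *)
    by rewrite (LagrangianE f W U v DK) (Lagrangian_pinfty f W U _ g_proper Du) leNye.
  rewrite (LagrangianE f W U v DK) (LagrangianE f W U _ Du) -EFinB lee_fin.
  by rewrite div1r invfM [2^-1 * _]mulrC -mulrA; exact: gK.
- exists (phi xs)%:E; have [Jr Jl] := objective_min mixing_W g_proper sp.
  split=> //; have [C rC] := rphi; exists C => K K1.
  have [DK _] := gap K K1.
  rewrite big_split/= sumEFin -/(Gsum g _) (GsumE DK) lee_fin.
  exact: rC.
- have [C rC] := rB; exists (Num.sqrt 2 * C) => K K1.
  have [Cs CC] := mxsqrt_root (kron_laplacian_psd_root n mixing_W).
  have [Vs VV] := mxsqrt_root (Vmx_psd_root n mixing_W).
  set X := usubmx (average xbar K).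
  have E : norm2 (mxsqrt (kron_id (1%:M - W) n) *m X)
      = Num.sqrt 2 * norm2 (mxsqrt (Vmx n W) *m X).
    apply: (@pexpIrn _ 2); rewrite ?nnegrE ?mulr_ge0 ?norm2_ge0 ?sqrtr_ge0//.
    rewrite (norm2_root _ Cs CC) exprMn (norm2_root _ Vs VV) (sqr_sqrtr (ler0n R 2)).
    by rewrite /Vmx kron_idZ -scalemxAl innerZr mulrA divff ?mul1r// pnatr_eq0.
  rewrite E -mulrA ler_wpM2l ?sqrtr_ge0//; apply: le_trans (rC K K1).
  rewrite Bmx_mul -/X ler_sqrt ?inner_ge0// inner_col_mx lerDl; exact: inner_ge0.
Qed.
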